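(* Consider the following diagram of maps (all defined in the context): $\Pi\colon\mathcal{TP}\to\mathcal{IP}$; $\Lambda\colon\mathcal{TP}\to\mathcal{BP}$; $\Psi\colon\mathcal{BP}\to\mathcal{IP}$; $\Delta\colon\mathcal{GP}\to\mathcal{TP}$; $\gamma_{\mathcal{GP}}\colon\mathcal{GP}\to\mathcal{IP}$; $\Delta_+\colon\mathcal{GP}\to\mathcal{TP}_+$; $\gamma^+_{\mathcal{GP}}\colon\mathcal{GP}\to\mathcal{IP}_+$; $\varphi_{\mathcal{TP}}\colon\mathcal{TP}\to\mathcal{TP}_+$; $\varphi_{\mathcal{IP}}\colon\mathcal{IP}\to\mathcal{IP}_+$; $\Pi_+\colon\mathcal{TP}_+\to\mathcal{IP}_+$; $\Lambda_+\colon\mathcal{TP}_+\to\mathcal{BP}_+$; $\Psi_+^{-1}\colon\mathcal{IP}_+\to\mathcal{BP}_+$; $\pi_{\mathcal{TP}}\colon\mathcal{TP}\to\mathcal{TP}/{\equiv_{\mathcal{TP}}}$; $\pi_{\mathcal{IP}}\colon\mathcal{IP}\to\mathcal{IP}/{\equiv_{\mathcal{IP}}}$; $\pi^+_{\mathcal{TP}}\colon\mathcal{TP}_+\to\mathcal{TP}/{\equiv_{\mathcal{TP}}}$; $\pi^+_{\mathcal{IP}}\colon\mathcal{IP}_+\to\mathcal{IP}/{\equiv_{\mathcal{IP}}}$; $\pi^+_{\mathcal{BP}}\colon\mathcal{BP}_+\to\mathcal{BP}/{\equiv_{\mathcal{BP}}}$; $\hat\Pi\colon\mathcal{TP}/{\equiv_{\mathcal{TP}}}\to\mathcal{IP}/{\equiv_{\mathcal{IP}}}$;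 $\hat\Lambda\colon\mathcal{TP}/{\equiv_{\mathcal{TP}}}\to\mathcal{BP}/{\equiv_{\mathcal{BP}}}$; $\hat\Psi\colon\mathcal{BP}/{\equiv_{\mathcal{BP}}}\to\mathcal{IP}/{\equiv_{\mathcal{IP}}}$. Then: (a) The diagram is commutative: any two paths (composites of the listed maps) with the same starting point and the same end point produce the same function. Moreover: (a.1) any path from $\mathcal{BP}$ to $\mathcal{BP}_+$ is the map $\lambda\mapsto\lambda_+$; and (a.2) any path from $\mathcal{BP}$ to $\mathcal{BP}/{\equiv_{\mathcal{BP}}}$ is the map $\lambda\mapsto[\lambda]_{\mathcal{BP}}$. (b) $\Pi$, $\Lambda$, $\pi_{\mathcal{TP}}$, $\pi_{\mathcal{IP}}$, $\Delta_+$, $\varphi_{\mathcal{IP}}$, $\varphi_{\mathcal{TP}}$, $\gamma_{\mathcal{GP}}$ and $\gamma^+_{\mathcal{GP}}$ are surjective. (c) $\Psi$, $\Delta$, $\Pi_+$, $\Psi_+$, $\Lambda_+$, $\hat\Pi$, $\hat\Psi$, $\hat\Lambda$, $\pi^+_{\mathcal{IP}}$, $\pi^+_{\mathcal{TP}}$ and $\pi^+_{\mathcal{BP}}$ are bijective.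
   Context: Trees. A tree (of sequences) is a non-empty set $T$ of finite sequences with entries in some set, closed under initial segments and ordered by $s\subseteq t$ ($t$ extends $s$); its root is $\langle\,\rangle$. $\mathcal T$ is the collection of all countable trees of sequences. $\mathrm{succ}_T(t)$ is the set of $t'\in T$ extending $t$ with $|t'|=|t|+1$; $\max T=\{t\in T:\mathrm{succ}_T(t)=\emptyset\}$; $\lim T$ is the set of infinite sequences $x$ (indexed by $\omega$) with $x\upharpoonright n\in T$ for all $n<\omega$; $[T]=\lim T\cup\max T$, with the topology generated by the sets $[t]_T=\{x\in[T]:t\subseteq x\}$, $t\in T$. Collections. $\mathcal{TP}$ is the collection of all $\bar\mu=\langle\mu_t:t\in T\smallsetminus\max T\rangle$, for some $T\in\mathcal T$, where each $\mu_t$ is a probability measure on $\mathcal P(\mathrm{succ}_T(t))$; this $T$ is denoted $T_{\bar\mu}$. $\mathcal{IP}$ is the collection of all inductive probability measures: measures $\Xi$ on $\mathcal P(T)$, for some $T\in\mathcal T$ (denoted $T_\Xi$), with $\Xi(\{\langle\,\rangle\})=1$ and $\Xi(\mathrm{succ}_T(t))=\Xi(\{t\})$ for all $t\in T\smallsetminus\max T$. $\mathcal{BP}$ is the collection of all probability measures $\lambda$ on the Borel $\sigma$-algebra $\mathcal B([T])$ for some $T\in\mathcal T$ (denoted $T_\lambda$). Basic maps. For $\bar\mu\in\mathcal{TP}$, $\Pi(\bar\mu)=\Xi^{\bar\mu}$ is the measure on $\mathcal P(T_{\bar\mu})$ determined by $\Xi^{\bar\mu}(\{t\})=\prod_{k<|t|}\mu_{t\upharpoonright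 k}(\{t\upharpoonright(k+1)\})$. For $\lambda\in\mathcal{BP}$, $\Psi(\lambda)=\Xi^\lambda$ is the measure on $\mathcal P(T_\lambda)$ determined by $\Xi^\lambda(\{t\})=\lambda([t]_{T_\lambda})$. For $\bar\mu\in\mathcal{TP}$, $\Lambda(\bar\mu)=\lambda^{\bar\mu}$ is the unique probability measure on $\mathcal B([T_{\bar\mu}])$ with $\lambda^{\bar\mu}([t])=\Xi^{\bar\mu}(\{t\})$ for all $t\in T_{\bar\mu}$. Positive parts. $N_\Xi=\{t\in T_\Xi:\Xi(\{t\})=0\}$, $N_{\bar\mu}=N_{\Xi^{\bar\mu}}$, $N_\lambda=\{t\in T_\lambda:\lambda([t])=0\}$; $T^+_\Xi=T_\Xi\smallsetminus N_\Xi$, $T^+_{\bar\mu}=T_{\bar\mu}\smallsetminus N_{\bar\mu}$, $T^+_\lambda=T_\lambda\smallsetminus N_\lambda$ (these are trees in $\mathcal T$). $\Xi_+=\Xi\upharpoonright\mathcal P(T^+_\Xi)$; $\bar\mu_+=\langle\mu_t\upharpoonright\mathcal P(T^+_{\bar\mu}\cap\mathrm{succ}_{T_{\bar\mu}}(t)):t\in T^+_{\bar\mu}\smallsetminus\max T^+_{\bar\mu}\rangle$; $\lambda_+=\lambda\upharpoonright\mathcal B([T^+_\lambda])$. $\mathcal{TP}_+$ is the collection of $\bar\mu\in\mathcal{TP}$ such that $\mu_t(\{s\})>0$ for all $t\in T_{\bar\mu}\smallsetminus\max T_{\bar\mu}$ and $s\in\mathrm{succ}_{T_{\bar\mu}}(t)$;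 $\mathcal{IP}_+$ is the collection of $\Xi\in\mathcal{IP}$ with $\Xi(\{t\})>0$ for all $t\in T_\Xi$; $\mathcal{BP}_+$ is the collection of $\lambda\in\mathcal{BP}$ with $\lambda([t])>0$ for all $t\in T_\lambda$. $\varphi_{\mathcal{TP}}(\bar\mu)=\bar\mu_+$, $\varphi_{\mathcal{IP}}(\Xi)=\Xi_+$, $\Pi_+=\Pi\upharpoonright\mathcal{TP}_+$, $\Lambda_+=\Lambda\upharpoonright\mathcal{TP}_+$, $\Psi_+=\Psi\upharpoonright\mathcal{BP}_+\colon\mathcal{BP}_+\to\mathcal{IP}_+$. Equivalences. $\bar\mu\equiv_{\mathcal{TP}}\bar\nu$ iff $\bar\mu_+=\bar\nu_+$; $\Xi\equiv_{\mathcal{IP}}\Xi'$ iff $\Xi_+=\Xi'_+$; $\lambda\equiv_{\mathcal{BP}}\lambda'$ iff $\lambda_+=\lambda'_+$; $[\cdot]_{\mathcal{TP}},[\cdot]_{\mathcal{IP}},[\cdot]_{\mathcal{BP}}$ denote equivalence classes. $\pi_{\mathcal{TP}}$, $\pi_{\mathcal{IP}}$ send an element to its class; $\pi^+_{\mathcal{TP}}$, $\pi^+_{\mathcal{IP}}$, $\pi^+_{\mathcal{BP}}$ send an element of $\mathcal{TP}_+$, $\mathcal{IP}_+$, $\mathcal{BP}_+$, respectively, to its class. $\hat\Pi([\bar\mu]_{\mathcal{TP}})=[\Pi(\bar\mu)]_{\mathcal{IP}}$, $\hat\Psi([\lambda]_{\mathcal{BP}})=[\Psi(\lambda)]_{\mathcal{IP}}$,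 $\hat\Lambda([\bar\mu]_{\mathcal{TP}})=[\Lambda(\bar\mu)]_{\mathcal{BP}}$ (well defined). General sequences. $\mathcal{GP}$ is the collection of pairs $\bar\eta=(\Xi,\langle\nu_t:t\in N_\Xi\smallsetminus\max T_\Xi\rangle)$ with $\Xi\in\mathcal{IP}$ and each $\nu_t$ a probability measure on $\mathcal P(\mathrm{succ}_{T_\Xi}(t))$. For such $\bar\eta$, $\Delta(\bar\eta)=\bar\mu^{\bar\eta}\in\mathcal{TP}$ has tree $T_\Xi$ and, for $t\in T_\Xi\smallsetminus\max T_\Xi$ and $s\in\mathrm{succ}_{T_\Xi}(t)$, $\mu^{\bar\eta}_t(\{s\})=\Xi(\{s\})/\Xi(\{t\})$ if $t\notin N_\Xi$ and $\mu^{\bar\eta}_t(\{s\})=\nu_t(\{s\})$ if $t\in N_\Xi$. $\gamma_{\mathcal{GP}}(\bar\eta)=\Xi$, $\gamma^+_{\mathcal{GP}}(\bar\eta)=\Xi_+$, $\Delta_+(\bar\eta)=(\bar\mu^{\bar\eta})_+$. *)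

(* Defs.v *)
From HB Require Import structures.
From mathcomp Require Import all_boot all_order all_algebra.
From mathcomp Require Import all_classical all_reals all_analysis.
From mathcomp Require Import generic_quotient.
Set Implicit Arguments.
Unset Strict Implicit.
Unset Printing Implicit Defensive.
Import Order.TTheory GRing.Theory Num.Theory.
Local Open Scope classical_set_scope.
Local Open Scope ring_scope.
Local Open Scope ereal_scope.
Local Open Scope quotient_scope.

Section discrete_space.
Context {X : choiceType} {S : set X}.

(* A nonempty set S, as a type, with the sigma-algebra P(S); nonemptiness is
   required because measurable types are pointed. *)
Definition discr (S0 : S !=set0) : Type := set_type S.

Variable S0 : S !=set0.

HB.instance Definition _ := Choice.copy (discr S0) (set_type S).

Lemma discr_point : discr S0.
Proof. by case: (cid S0) => x Sx; exists x; exact: mem_set. Qed.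

HB.instance Definition _ := isPointed.Build (discr S0) discr_point.
HB.instance Definition _ := @isMeasurable.Build default_measure_display
  (discr S0) (@discrete_measurable (discr S0)) (@discrete_measurable0 _)
  (@discrete_measurableC _) (@discrete_measurableU _).

End discrete_space.

Section trees.
Variable A : choiceType.
Implicit Types s t u : seq A.

(* Countable trees of sequences with entries in A. *)
Record ctree := CTree {
  node : set (seq A);
  tree_neq0 : node !=set0;
  tree_closed : forall s t, prefix s t -> node t -> node s;
  tree_countable : countable node }.

Definition succ (T : ctree) t : set (seq A) :=
  [set s | [/\ node T s, prefix t s & size s = (size t).+1]].

Definition maxT (T : ctree) : set (seq A) := [set t | node T t /\ succ T t = set0].

Definition inner (T : ctree) : set (seq A) := node T `\` maxT T.

Definition limT (T : ctree) : set (nat -> A) :=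
  [set x | forall n, node T (mkseq x n)].

(* Finite or infinite sequences; [initseg t x] is t <= x. *)
Definition fiseq : Type := (seq A + (nat -> A))%type.

Definition initseg t (x : fiseq) : bool :=
  match x with
  | inl s => prefix t s
  | inr f => t == mkseq f (size t)
  end.

Definition body (T : ctree) : set fiseq := inl @` maxT T `|` inr @` limT T.

Lemma succ_neq0 (T : ctree) t : inner T t -> succ T t !=set0.
Proof.
by move=> [Tt /not_andP[//|/eqP/set0P]].
Qed.

Lemma tree_nil (T : ctree) : node T [::].
Proof. by have [t Tt] := tree_neq0 T; apply: tree_closed Tt; case: t. Qed.

Lemma tree_chain (T : ctree) (P : set (seq A)) t0 : node T t0 -> P t0 ->
  (forall t, node T t -> P t -> exists2 s, succ T t s & P s) ->
  exists2 x, limT T x & forall n, (size t0 <= n)%N -> P (mkseq x n).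
Proof.
move=> Tt0 Pt0 step.
have [f fP] : {f : seq A -> seq A &
    forall t, node T t /\ P t -> succ T t (f t) /\ P (f t)}.
  apply: (@choice _ _ (fun t s => node T t /\ P t -> succ T t s /\ P s)) => t.
  have [[Tt Pt]|] := pselect (node T t /\ P t); last by exists [::].
  by have [s ? ?] := step _ Tt Pt; exists s.
pose u n := iter n f t0.
have uP n : node T (u n) /\ P (u n).
  elim: n => [//|n ih] /=; have [[? ? ?] ?] := fP _ ih; split => //.
have us n : succ T (u n) (u n.+1) by have [] := fP _ (uP n).
have sz n : size (u n) = (size t0 + n)%N.
  elim: n => [|n ih]; first by rewrite addn0.
  by have [_ _ ->] := us n; rewrite ih addnS.
have upre n m : prefix (u n) (u (n + m)%N).
  elim: m => [|m ih]; first by rewrite addn0 prefix_refl.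
  by apply: (prefix_trans ih); rewrite addnS; have [] := us (n + m)%N.
have [a0 _] : exists a : A, True.
  case E : (u 1%N) (sz 1%N) => [|a s] /=; first by rewrite addn1.
  by move=> _; exists a.
pose x k := nth a0 (u k.+1) k.
have xu n : mkseq x (size (u n)) = u n.
  apply: (@eq_from_nth _ a0); first by rewrite size_mkseq.
  move=> i; rewrite size_mkseq => ilt; rewrite nth_mkseq // /x.
  have [le|lt] := leqP n i.+1.
    have /prefixP[s ->] : prefix (u n) (u i.+1).
      by rewrite -(subnKC le); exact: upre.
    by rewrite nth_cat ilt.
  have /prefixP[s ->] : prefix (u i.+1) (u n).
    by rewrite -(subnKC (ltnW lt)); exact: upre.
  by rewrite nth_cat sz addnS ltnS leq_addl.
have xn n : prefix (mkseq x n) (u n).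
  have le : (n <= size (u n))%N by rewrite sz leq_addl.
  rewrite prefixE -[u n]xu size_mkseq; apply/eqP.
  by rewrite /mkseq -map_take take_iota; congr map; congr iota; exact/minn_idPl.
exists x => [n|n len]; first by apply: tree_closed (uP n).1.
have -> : n = size (u (n - size t0)%N) by rewrite sz subnKC.
by rewrite xu; exact: (uP _).2.
Qed.

Lemma body_neq0 (T : ctree) : body T !=set0.
Proof.
have [[t mt]|nmax] := pselect (exists t, maxT T t).
  by exists (inl t); left; exists t.
have [|x limx _] := @tree_chain T setT [::] (tree_nil T) I.
  move=> t Tt _; have [|s ?] := @succ_neq0 T t; last by exists s.
  by split=> // mt; apply: nmax; exists t.
by exists (inr x); right; exists x.
Qed.

(* The space [T] of maximal branches. *)
Definition branch (T : ctree) : Type := set_type (body T).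

Definition cone (T : ctree) t : set (branch T) := [set x | initseg t (val x)].
Arguments cone T t _ : clear implicits.

Section branch_space.
Variable T : ctree.

HB.instance Definition _ := Choice.copy (branch T) (set_type (body T)).

Lemma branch_point : branch T.
Proof. by case: (cid (body_neq0 T)) => x Tx; exists x; exact: mem_set. Qed.

HB.instance Definition _ := isPointed.Build (branch T) branch_point.

Lemma initseg_prefix s t x : prefix s t -> initseg t x -> initseg s x.
Proof.
case: x => [u|f] /=; first exact: prefix_trans.
rewrite prefixE => /eqP st /eqP tf; apply/eqP; rewrite -[LHS]st tf.
rewrite /mkseq -map_take take_iota; congr map; congr iota; apply/minn_idPl.
by rewrite -st size_take_min geq_minr.
Qed.

Lemma initseg_total s t x : initseg s x -> initseg t x ->
  prefix s t || prefix t s.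
Proof.
have main u v : (size u <= size v)%N -> initseg u x -> initseg v x ->
    prefix u v.
  case: x => [w|f] /= le.
    by rewrite !prefixE => /eqP uw /eqP <-; rewrite take_takel // uw.
  move=> /eqP -> /eqP ->; rewrite prefixE size_mkseq.
  by rewrite /mkseq -map_take take_iota (minn_idPl le).
move=> sx tx; case: (leqP (size s) (size t)) => [le|/ltnW le].
  by rewrite (main s t).
by rewrite orbC (main t s).
Qed.

Lemma cone_cover : \bigcup_(B in [set cone T t | t in node T]) B = setT.
Proof.
apply/seteqP; split=> // x _; exists (cone T [::]).
  by exists [::] => //; exact: tree_nil.
by rewrite /cone /=; case: (val x) => [[]|f].
Qed.

Lemma cone_join (B C : set (branch T)) x :
  [set cone T t | t in node T] B -> [set cone T t | t in node T] C ->
  B x -> C x ->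
  exists D, [/\ [set cone T t | t in node T] D, D x & D `<=` B `&` C].
Proof.
move=> [s Ts <-] [t Tt <-] sx tx.
have /orP[st|ts] := initseg_total sx tx.
  by exists (cone T t); split=> // [|y ty]; [exists t|split=> //;
     exact: initseg_prefix st ty].
by exists (cone T s); split=> // [|y sy]; [exists s|split=> //;
   exact: initseg_prefix ts sy].
Qed.

(* The topology with base the sets [t]_T. *)
HB.instance Definition _ := @isBaseTopological.Build (branch T)
  (set (branch T)) [set cone T t | t in node T] id cone_cover cone_join.

Definition borel := g_sigma_algebraType (@open (branch T)).

End branch_space.
End trees.
Arguments cone {A} T t _.

Section topo.
Variables (A : choiceType) (T : ctree A).

Lemma open_cone t : node T t -> open (cone T t).
Proof.
move=> Tt; exists [set cone T t]; first by move=> _ ->; exists t.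
by rewrite bigcup_set1.
Qed.

Lemma open_coneP (U : set (branch T)) : open U ->
  exists2 S, S `<=` node T & U = \bigcup_(t in S) cone T t.
Proof.
move=> [D' D'D <-]; exists [set t | node T t /\ D' (cone T t)].
  by move=> t [].
apply/seteqP; split=> x.
  by move=> [B D'B Bx]; have [t Tt tB] := D'D _ D'B; rewrite -tB in D'B Bx; exists t.
by move=> [t [Tt D't] tx]; exists (cone T t).
Qed.

Lemma measurable_cone t : node T t -> measurable (cone T t : set (borel T)).
Proof. by move=> /open_cone; exact: sub_sigma_algebra. Qed.

End topo.

Section measures.
Variable R : realType.

Lemma measure_esum d (M : measurableType d) (m : {measure set M -> \bar R})
    (I : choiceType) (S : set I) (F : I -> set M) :
  countable S -> (forall i, S i -> measurable (F i)) -> trivIset S F ->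
  m (\bigcup_(i in S) F i) = \esum_(i in S) m (F i).
Proof.
move=> /countable_injP[f finj] mF tF.
pose G n := \bigcup_(i in S `&` f @^-1` [set n]) F i.
have GF i : S i -> G (f i) = F i.
  move=> Si; apply/seteqP; split=> [x [j [Sj /= fji] Fjx]|x Fix]; last by exists i.
  by rewrite -(finj _ _ _ _ fji) ?inE.
have G0 n : ~ (f @` S) n -> G n = set0.
  move=> nS; apply/seteqP; split=> // x [i [Si fi] _].
  by apply: nS; exists i.
have mG n : measurable (G n).
  have [[i Si <-]|/G0 ->//] := pselect ((f @` S) n).
  by rewrite GF //; exact: mF.
have UG : \bigcup_(i in S) F i = \bigcup_n G n.
  apply/seteqP; split=> x; first by move=> [i Si Fx]; exists (f i); rewrite ?GF.
  by move=> [n _ [i [Si _] Fx]]; exists i.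
have tG : trivIset setT G.
  move=> m1 n _ _ [x [[i [Si <-] Fx] [j [Sj <-] Fx']]].
  by congr f; apply: tF => //; exists x.
rewrite UG measure_bigcup //.
rewrite nneseries_esum // set_mem_set [RHS](_ : _ = \esum_(n in f @` S) m (G n)); last first.
  rewrite esum_image; last by move=> i j Si Sj; apply: finj.
  by apply: eq_esum => i Si; rewrite GF.
rewrite esum_mkcond [RHS]esum_mkcond; apply: eq_esum => n _.
rewrite in_setT.
have [/set_mem nS|/negP nS] := boolP (n \in f @` S); first by [].
by rewrite G0 ?measure0 // => fn; apply: nS; exact: mem_set.
Qed.

Section pmass.
Context {X : choiceType} {S : set X} (S0 : S !=set0) (w : X -> \bar R).
Hypothesis w0 : forall x, 0 <= w x.

(* The measure on P(S) with point masses w; the unused proof that w is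
   nonnegative is there for the measure structure. *)
Definition pmass & (forall x, 0 <= w x) := fun B : set (discr S0) =>
  \esum_(x in B) w (val x).

Let pmass0 : pmass w0 set0 = 0.
Proof. exact: esum_set0. Qed.

Let pmass_ge0 B : 0 <= pmass w0 B.
Proof. by apply: esum_ge0 => x _; exact: w0. Qed.

Let pmass_sigma_additive : semi_sigma_additive (pmass w0).
Proof.
move=> F mF tF mUF; rewrite /pmass nneseries_sum_bigcup //.
by apply: is_cvg_nneseries => n _ _; exact: esum_ge0.
Qed.

HB.instance Definition _ := isMeasure.Build _ (discr S0) R (pmass w0)
  pmass0 pmass_ge0 pmass_sigma_additive.

Lemma pmass_val (C : set X) : C `<=` S ->
  pmass w0 [set x | C (val x)] = \esum_(x in C) w x.
Proof.
move=> CS; rewrite /pmass -(esum_image _ (fun x : discr S0 => val x) w); last first.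
  by move=> x y _ _; exact: val_inj.
congr esum; apply/seteqP; split=> x; first by move=> [y Cy <-].
by move=> Cx; exists (SigSub (mem_set (CS _ Cx))).
Qed.

Lemma pmass1 x : S x -> pmass w0 [set y | val y = x] = w x.
Proof. by move=> Sx; rewrite (@pmass_val [set x]) ?esum_set1 // => _ ->. Qed.

End pmass.
Arguments pmass {X S} S0 {w} w0 B.

Section mrestr.
Context {X : choiceType} {S S' : set X} (S0 : S !=set0) (S'0 : S' !=set0).
Variable m : {measure set (discr S0) -> \bar R}.

(* The restriction to P(S') of a measure on P(S), for S' included in S. *)
Definition mrestrict := fun B : set (discr S'0) =>
  m (val @^-1` (val @` B)).

Let mrestrict0 : mrestrict set0 = 0.
Proof. by rewrite /mrestrict image_set0 preimage_set0 measure0. Qed.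

Let mrestrict_ge0 B : 0 <= mrestrict B.
Proof. exact: measure_ge0. Qed.

Let mrestrict_sigma_additive : semi_sigma_additive mrestrict.
Proof.
move=> F mF tF mUF; rewrite /mrestrict image_bigcup preimage_bigcup.
apply: measure_semi_sigma_additive => //.
move=> i j _ _ [x [[y Fy yx] [z Fz zx]]]; apply: (tF i j) => //.
exists y; split=> //; suff -> : y = z by [].
by apply: val_inj; rewrite yx.
Qed.

HB.instance Definition _ := isMeasure.Build _ (discr S'0) R mrestrict
  mrestrict0 mrestrict_ge0 mrestrict_sigma_additive.

Lemma mrestrict_val (C : set X) : C `<=` S' ->
  mrestrict [set x | C (val x)] = m [set x | C (val x)].
Proof.
move=> CS; rewrite /mrestrict; congr (m _); apply/seteqP; split=> x /=.
  by move=> [y Cy <-].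
by move=> Cx; exists (SigSub (mem_set (CS _ Cx))).
Qed.

End mrestr.
Arguments mrestrict {X S S' S0} S'0 m B.
Arguments mrestrict_val {X S S' S0 S'0} m C.

Lemma discr_measureE {X : choiceType} {S : set X} (S0 : S !=set0)
    (m : {measure set (discr S0) -> \bar R}) (C : set X) :
  countable S -> C `<=` S ->
  m [set x | C (val x)] = \esum_(x in C) m [set y | val y = x].
Proof.
move=> cS CS; rewrite -measure_esum //.
- by congr (m _); apply/seteqP; split=> x /=; [exists (val x)|move=> [y Cy ->]].
- by apply: sub_countable cS; exact: subset_card_le.
- by move=> i j _ _ [x [/= -> ->]].
Qed.

End measures.
Arguments pmass {R X S} S0 {w} w0 B.
Arguments mrestrict {R X S S' S0} S'0 m B.
Arguments mrestrict_val {R X S S' S0 S'0} m C.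

Section inductive_weights.
Context {A : choiceType} {R : realType} (T : ctree A).
Implicit Types (s t u : seq A) (w : seq A -> \bar R).

(* w is the family of point masses of an inductive probability measure. *)
Record indw w : Prop := Indw {
  indw_ge0 : forall t, 0 <= w t;
  indw_nil : w [::] = 1;
  indw_succ : forall t, inner T t -> \esum_(s in succ T t) w s = w t }.

Lemma succ_inner s t : succ T t s -> inner T t.
Proof.
move=> st; have [Ts ts _] := st; split; first exact: tree_closed Ts.
by move=> [_ E]; have : set0 s by rewrite -E.
Qed.

Lemma succ_sub t : succ T t `<=` node T.
Proof. by move=> s []. Qed.

Lemma succ_rcons t a : node T (rcons t a) -> succ T t (rcons t a).
Proof. by move=> ?; split; rewrite ?size_rcons ?prefix_rcons. Qed.

Lemma succP s t : succ T t s -> exists a, s = rcons t a.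
Proof.
move=> [_ /prefixP[[|a [|b u]] ->]]; rewrite size_cat /=.
- by rewrite addn0 => /n_Sn.
- by exists a; rewrite cats1.
- by rewrite addnS addnS => -[] /eqP; rewrite -addnS -[X in _ == X]addn0 eqn_add2l.
Qed.

Lemma prefix_rconsP s t a : prefix s (rcons t a) -> prefix s t \/ s = rcons t a.
Proof.
move=> /prefixP[u]; elim/last_ind: u => [|u b _].
  by rewrite cats0 => ->; right.
by rewrite -rcons_cat => /rcons_inj[-> _]; left; exact: prefix_prefix.
Qed.

Lemma succ_triv : trivIset setT (succ T).
Proof.
by move=> t u _ _ [x [/succP[a ->] /succP[b /rcons_inj[]]]].
Qed.

Section indw_theory.
Variables (w : seq A -> \bar R) (iw : indw w).

Lemma indw_le_succ s t : succ T t s -> w s <= w t.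
Proof.
move=> st; rewrite -(indw_succ iw (succ_inner st)).
rewrite -[leLHS](@esum_set1 _ _ s w) ?(indw_ge0 iw) //.
rewrite esum_mkcond [leRHS]esum_mkcond; apply: le_esum => x _.
case: ifPn; first by rewrite inE => ->; rewrite mem_set.
by move=> _; case: ifP => _ //; exact: indw_ge0.
Qed.

Lemma indw_le s t : node T s -> prefix t s -> w s <= w t.
Proof.
move=> Ts /prefixP[u su]; rewrite {}su in Ts *.
elim/last_ind: u Ts => [|u a ih]; first by rewrite cats0.
rewrite -rcons_cat => Ts.
have ss := succ_rcons Ts.
by apply: (le_trans (indw_le_succ ss)); apply: ih; case: (succ_inner ss).
Qed.

Lemma indw_le1 t : node T t -> w t <= 1.
Proof. by move=> Tt; rewrite -(indw_nil iw); apply: indw_le => //; exact: prefix0s. Qed.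

Lemma indw_fin t : node T t -> w t \is a fin_num.
Proof.
move=> Tt; rewrite ge0_fin_numE ?(indw_ge0 iw) //.
by apply: le_lt_trans (indw_le1 Tt) _; rewrite ltry.
Qed.

Let w0 := indw_ge0 iw.

Lemma esum_sub (I : choiceType) (S S' : set I) (f : I -> \bar R) :
  (forall i, 0 <= f i) -> S `<=` S' ->
  \esum_(i in S) f i <= \esum_(i in S') f i.
Proof.
move=> f0 SS'; rewrite esum_mkcond [leRHS]esum_mkcond; apply: le_esum => i _.
case: ifPn => [/set_mem/SS' Si|_]; first by rewrite mem_set.
by case: ifP.
Qed.

(* A family of cones that covers a cone has at least its weight. *)
Lemma cone_le_esum t (S : set (seq A)) : node T t -> S `<=` node T ->
  cone T t `<=` \bigcup_(s in S) cone T s -> w t <= \esum_(s in S) w s.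
Proof.
move=> Tt ST cov; have [//|lt] := leP (w t) (\esum_(s in S) w s).
have le1 s : S s -> w s <= \esum_(u in S) w u.
  move=> Ss; rewrite -[leLHS](@esum_set1 _ _ s w) //.
  by apply: esum_sub => // _ ->.
pose E u := \esum_(s in [set s | S s /\ prefix u s]) w s.
pose P u := [/\ prefix t u, E u < w u & forall s, S s -> ~~ prefix s u].
have Pt : P t.
  split; first exact: prefix_refl.
    apply: (@le_lt_trans _ _ (\esum_(s in S) w s)); last by [].
    by apply: esum_sub; [exact: w0|move=> s []].
  move=> s Ss; apply/negP => st; move: lt; rewrite ltNge.
  by rewrite (le_trans _ (le1 _ Ss)) ?indw_le.
have step u : node T u -> P u -> exists2 v, succ T u v & P v.
  move=> Tu [tu Eu nu].
  have iu : inner T u.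
    split=> // mu; have ub : body T (inl u) by left; exists u.
    have [|s Ss su] := cov (SigSub (mem_set ub)); first exact: tu.
    by move/negP: (nu _ Ss); apply; exact: su.
  have [v uv Ev] : exists2 v, succ T u v & E v < w v.
    apply: contrapT => nex.
    move: Eu; rewrite ltNge -(indw_succ iw iu) => /negP; apply.
    apply: (@le_trans _ _ (\esum_(v in succ T u) E v)).
      by apply: le_esum => v uv; rewrite leNgt; apply/negP => ?; apply: nex; exists v.
    rewrite /E esum_esum; last by [].
    rewrite -(esum_image _ snd w).
      apply: esum_sub => // s [[v s'] [/= uv [Ss' vs']] <-]; split=> //=.
      by have [_ uv' _] := uv; exact: prefix_trans uv' vs'.
    move=> [v1 s1] [v2 s2] /set_mem[/= uv1 [_ p1]] /set_mem[/= uv2 [_ p2]] s12.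
    rewrite -{}s12 in p2 *; congr pair.
    have [_ _ z1] := uv1; have [_ _ z2] := uv2.
    by move: p1 p2; rewrite !prefixE z1 z2 => /eqP <- /eqP <-.
  exists v => //; have [Tv puv sv] := uv; split=> //; first exact: prefix_trans puv.
  move=> s Ss; apply/negP => psv.
  have [a va] := succP uv.
  have sve : s = v.
    move: psv; rewrite va => /prefix_rconsP[psu|//].
    by move: (nu _ Ss); rewrite psu.
  move: Ev; rewrite ltNge => /negP; apply.
  rewrite -[leLHS](@esum_set1 _ _ v w) //; apply: esum_sub => // _ ->.
  by split; [rewrite -sve|exact: prefix_refl].
have [x limx Px] := tree_chain Tt Pt step.
have bx : body T (inr x) by right; exists x.
have [|s Ss /= /eqP sx] := cov (SigSub (mem_set bx)).
  have [tx _ _] := Px _ (leqnn _); rewrite /cone /=.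
  by move: tx; rewrite prefixE -{1}(size_mkseq x (size t)) take_size eq_sym.
have [_ _ /(_ _ Ss)] := Px _ (leq_maxl (size t) (size s)).
rewrite {1}sx prefixE size_mkseq /mkseq -map_take take_iota.
by rewrite (minn_idPl (leq_maxr _ _)) eqxx.
Qed.
End indw_theory.
End inductive_weights.

Section outer_measure_countable.
Variable R : realType.

Lemma outer_measure_esum (M : Type) (m : {outer_measure set M -> \bar R})
    (I : choiceType) (S : set I) (F : I -> set M) :
  countable S -> m (\bigcup_(i in S) F i) <= \esum_(i in S) m (F i).
Proof.
move=> /countable_injP[f finj].
pose G n := \bigcup_(i in S `&` f @^-1` [set n]) F i.
have GF i : S i -> G (f i) = F i.
  move=> Si; apply/seteqP; split=> [x [j [Sj /= fji] Fjx]|x Fix]; last by exists i.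
  by rewrite -(finj _ _ _ _ fji) ?inE.
have G0 n : ~ (f @` S) n -> G n = set0.
  move=> nS; apply/seteqP; split=> // x [i [Si fi] _].
  by apply: nS; exists i.
have -> : \bigcup_(i in S) F i = \bigcup_n G n.
  apply/seteqP; split=> x; first by move=> [i Si Fx]; exists (f i); rewrite ?GF.
  by move=> [n _ [i [Si _] Fx]]; exists i.
apply: le_trans (outer_measure_sigma_subadditive m G) _.
rewrite nneseries_esumT; last by move=> n; exact: outer_measure_ge0.
rewrite [leRHS](_ : _ = \esum_(n in f @` S) m (G n)); last first.
  rewrite esum_image; last by move=> i j Si Sj; apply: finj.
  by apply: eq_esum => i Si; rewrite GF.
rewrite [leRHS]esum_mkcond; apply: le_esum => n _.
have [//|/negP nS] := boolP (n \in f @` S).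
by rewrite G0 ?outer_measure0 // => fn; apply: nS; exact: mem_set.
Qed.

Lemma esum_image_le (I J : choiceType) (K : set I) (f : I -> J)
    (a : J -> \bar R) : (forall j, 0 <= a j) ->
  \esum_(j in f @` K) a j <= \esum_(i in K) a (f i).
Proof.
move=> a0.
have [g gP] : {g : J -> option I & forall j, (f @` K) j ->
    exists i, [/\ g j = Some i, K i & f i = j]}.
  apply: (@choice _ _ (fun j o => (f @` K) j ->
    exists i, [/\ o = Some i, K i & f i = j])) => j.
  have [[i Ki fij]|] := pselect ((f @` K) j); last by exists None.
  by exists (Some i) => _; exists i.
pose K' := [set i | K i /\ g (f i) = Some i].
have -> : f @` K = f @` K'.
  apply/seteqP; split=> [j fj|j [i [Ki _] <-]]; last by exists i.
  by have [i [gj Ki fi]] := gP _ fj; exists i => //; split=> //; rewrite fi.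
rewrite esum_image; last first.
  by move=> i j /set_mem[_ gi] /set_mem[_ gj] fij; move: gi; rewrite fij gj => -[].
by apply: esum_sub => // i [].
Qed.

End outer_measure_countable.

Lemma cone_succ {A : choiceType} (T : ctree A) t : inner T t ->
  cone T t `<=` \bigcup_(v in succ T t) cone T v.
Proof.
move=> [Tt nt] [[u|f] bx] /=; rewrite /cone /=.
  move=> /prefixP[[|a v] uE].
    rewrite cats0 in uE; exfalso; apply: nt; move/set_mem: bx.
    by move=> [[u' mu [uu']]|[? ? //]]; rewrite -uE -uu'.
  have Tu : node T u.
    by move/set_mem: bx => [[u' [Tu' _] [<-]]|[? ? //]].
  exists (rcons t a).
    apply: succ_rcons; apply: tree_closed Tu.
    by rewrite uE -cat_rcons; exact: prefix_prefix.
  by rewrite /= uE -cat_rcons; exact: prefix_prefix.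
move=> /eqP tf.
have Tf n : node T (mkseq f n).
  by move/set_mem: bx => [[? ? //]|[f' lf [<-]]].
exists (mkseq f (size t).+1); last first.
  by apply/eqP; rewrite size_mkseq.
split=> //; last by rewrite size_mkseq.
rewrite {1}tf prefixE size_mkseq.
by rewrite /mkseq -map_take take_iota (minn_idPl (leqnSn _)).
Qed.

Lemma branch_probability_unique (R : realType) (A : choiceType) (T : ctree A)
    (p q : probability (borel T) R) :
  (forall t, node T t -> p (cone T t) = q (cone T t)) ->
  forall B, measurable B -> p B = q B.
Proof.
move=> pq; pose G : set (set (borel T)) :=
  [set B | B = set0 \/ exists2 t, node T t & B = cone T t].
have Gcone t : node T t -> G (cone T t) by right; exists t.
have mG : (measurable : set (set (borel T))) = <<s G >>.
  apply/seteqP; split.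
    apply: smallest_sub => [|U /open_coneP[S ST ->]].
      exact: smallest_sigma_algebra.
    suff : measurable (\bigcup_(t in S) cone T t : set (g_sigma_algebraType G)).
      by [].
    rewrite bigcup_set_type; apply: countable_bigcupT_measurable; last first.
      move=> [t St]; apply: sub_sigma_algebra; apply: Gcone; apply: ST.
      exact: set_mem St.
    rewrite (eq_countable (card_setT _)).
    by apply: sub_countable (tree_countable T); exact: subset_card_le.
  apply: smallest_sub; first exact: sigma_algebra_measurable.
  by move=> B [->|[t Tt ->]]; [exact: measurable0|exact: measurable_cone].
have GI : setI_closed G.
  move=> B C [->|[s Ts ->]]; first by rewrite set0I; left.
  move=> [->|[t Tt ->]]; first by rewrite setI0; left.
  have [st|nst] := boolP (prefix s t).
    by rewrite setIidr; [exact: Gcone|move=> x; exact: initseg_prefix].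
  have [ts|nts] := boolP (prefix t s).
    by rewrite setIidl; [exact: Gcone|move=> x; exact: initseg_prefix].
  left; apply/seteqP; split=> // x [sx tx].
  by move: (initseg_total sx tx); rewrite (negbTE nst) (negbTE nts).
apply: (measure_unique G (fun=> cone T [::]) mG GI) => [_|||k].
- exact/Gcone/tree_nil.
- by apply/seteqP; split=> // x _; exists 0%N => //; case: x => [[[]|f] bx].
- by move=> B [->|[t Tt ->]]; [rewrite !measure0|exact: pq].
by rewrite ltey_eq fin_num_measure //; apply: measurable_cone; exact: tree_nil.
Qed.

Section existence.
Context {A : choiceType} {R : realType} (T : ctree A) (w : seq A -> \bar R).
Hypothesis iw : indw T w.
Let X : Type := discr (body_neq0 T).
Let w0 := indw_ge0 iw.

Let g (B : set X) : \bar R := ereal_inf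
  [set r | (B = set0 /\ r = 0) \/ exists2 t, node T t & B = cone T t /\ r = w t].

Let g_ge0 B : 0 <= g B.
Proof. by apply: le_ereal_inf_tmp => r [[_ ->//]|[t _ [_ ->]]]. Qed.

Let g0 : g set0 = 0.
Proof.
apply/eqP; rewrite eq_le g_ge0 andbT; apply: ereal_inf_lbound.
by left.
Qed.

Let g_cone t : node T t -> g (cone T t) = w t.
Proof.
move=> Tt; apply/eqP; rewrite eq_le; apply/andP; split.
  by apply: ereal_inf_lbound; right; exists t.
apply: le_ereal_inf_tmp => r [[C0 ->]|[s Ts [Cst ->]]].
  rewrite -(@esum_set0 _ _ w); apply: (cone_le_esum iw) => // x.
  by rewrite C0.
rewrite -[leRHS](@esum_set1 _ _ s w) //; apply: (cone_le_esum iw) => //.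
  by move=> _ ->.
by rewrite bigcup_set1 Cst.
Qed.

Let gP B : B = set0 \/ (exists2 t, node T t & B = cone T t) \/ g B = +oo.
Proof.
have [|B0] := pselect (B = set0); first by left.
have [|Bc] := pselect (exists2 t, node T t & B = cone T t); first by right; left.
right; right; rewrite /g (_ : [set _ | _] = set0) ?ereal_inf0 //.
apply/seteqP; split=> // r [[//]|[t Tt [Bt _]]].
by apply: Bc; exists t.
Qed.

Let nu := mu_ext g.

HB.instance Definition _ := isOuterMeasure.Build R X nu
  (mu_ext0 g0 g_ge0) (mu_ext_ge0 g_ge0) (le_mu_ext g)
  (mu_ext_sigma_subadditive g_ge0).

Let nu_le_g B : nu B <= g B.
Proof.
apply: ereal_inf_lbound; exists (fun n => if n is 0%N then B else set0).
  by split=> [[]// _|t Xt]; exists 0%N.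
apply/cvg_lim => //; rewrite -cvg_shiftS.
rewrite (_ : [sequence _]_n = cst (g B)); first exact: cvg_cst.
by rewrite funeqE => n /=; rewrite big_nat_recl//= big1 ?adde0.
Qed.

Let nu_cone t : node T t -> nu (cone T t) = w t.
Proof.
move=> Tt; apply/eqP; rewrite eq_le -{1}g_cone // nu_le_g /=.
apply: le_ereal_inf_tmp => _ [F [_ cF] <-].
have [[k Fk]|Foo] := pselect (exists k, g (F k) = +oo).
  by rewrite (nneseries_pinfty _ _ Fk) ?leey.
have [s sP] : {s : nat -> seq A & forall n, F n <> set0 ->
    node T (s n) /\ F n = cone T (s n)}.
  apply: (@choice _ _ (fun n s => F n <> set0 ->
    node T s /\ F n = cone T s)) => n.
  have [->|[[s Ts Fs]|Fn]] := gP (F n); first by exists [::].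
    by exists s.
  by exfalso; apply: Foo; exists n.
pose K := [set n | F n <> set0].
apply: (@le_trans _ _ (\esum_(u in s @` K) w u)).
  apply: (cone_le_esum iw) => // [_ [n /sP[? _] <-] //|x /cF[n _ Fnx]].
  have Kn : K n by move=> F0; rewrite F0 in Fnx.
  by exists (s n); [exists n|rewrite -(sP _ Kn).2].
apply: (le_trans (esum_image_le _ _ w0)).
rewrite nneseries_esumT //.
rewrite [leLHS](_ : _ = \esum_(i in K) g (F i)).
  exact: esum_sub.
by apply: eq_esum => n /sP[Ts ->]; rewrite g_cone.
Qed.

Let nu_split s t : node T t -> prefix s t ->
  nu (cone T t) + nu (cone T s `\` cone T t) <= w s.
Proof.
move=> + /prefixP[u tE]; rewrite {t}tE.
elim/last_ind: u => [|u a ih].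
  by rewrite cats0 => Ts; rewrite setDv nu_cone // outer_measure0 adde0.
rewrite -rcons_cat; set t := s ++ u => Tta.
have ss := succ_rcons Tta; have it := succ_inner ss; have Tt : node T t by case: it.
apply: le_trans (ih Tt).
have -> : nu (cone T (s ++ u)) = w t by exact: nu_cone.
rewrite nu_cone // -(indw_succ iw it).
rewrite (esumID [set rcons t a]) //.
rewrite (_ : succ T t `&` [set rcons t a] = [set rcons t a]); last first.
  by apply/seteqP; split=> [x []|_ ->].
rewrite esum_set1 // -addeA; apply: leeD2l.
apply: (@le_trans _ _ (nu ((cone T t `\` cone T (rcons t a)) `|`
    (cone T s `\` cone T t)))).
  apply: le_outer_measure => x [sx nx].
  by have [tx|tx] := pselect (cone T t x); [left|right].
apply: le_trans (outer_measureU2 _ _ _) _; apply: leeD2r.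
rewrite [leRHS](_ : _ =
  \esum_(i in succ T t `&` ~` [set rcons t a]) nu (cone T i)); last first.
  by apply: eq_esum => v [[Tv _ _] _]; rewrite nu_cone.
apply: le_trans (outer_measure_esum _ _ _); last first.
  apply: sub_countable (tree_countable T); apply: subset_card_le => v [sv _].
  exact: succ_sub sv.
apply: le_outer_measure => x [tx nx]; have [v sv vx] := cone_succ it tx.
by exists v => //; split=> // va; apply: nx; rewrite -va.
Qed.

Let cone_cara t : node T t -> nu.-caratheodory (cone T t).
Proof.
move=> Tt; apply: le_caratheodory_measurable => Y.
apply: le_ereal_inf_tmp => _ [F [_ YF] <-].
apply: (@le_trans _ _ (\sum_(k <oo) (nu (F k `&` cone T t) +
                                      nu (F k `\` cone T t)))).
  rewrite nneseriesD; do ?[by move=> *; exact: outer_measure_ge0].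
  apply: leeD; apply: le_trans (outer_measure_sigma_subadditive nu _);
    apply: le_outer_measure => x [/YF[n _ Fx] tx]; by exists n.
apply: lee_nneseries => n _.
  by move=> _; apply: adde_ge0; exact: outer_measure_ge0.
have [->|[[s Ts ->]|->]] := gP (F n); last by rewrite leey.
  by rewrite set0I set0D !outer_measure0 adde0.
rewrite g_cone //.
have [st|nst] := boolP (prefix s t).
  rewrite (_ : cone T s `&` cone T t = cone T t); first exact: nu_split.
  by apply: setIidr => x; exact: initseg_prefix.
have [ts|nts] := boolP (prefix t s).
  have sub : cone T s `<=` cone T t by move=> x; exact: initseg_prefix.
  by rewrite (setIidl sub) (_ : cone T s `\` cone T t = set0) ?setD_eq0 // outer_measure0 adde0 nu_cone.
have dis : cone T s `&` cone T t = set0.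
  apply/seteqP; split=> // x [sx tx].
  by move: (initseg_total sx tx); rewrite (negbTE nst) (negbTE nts).
rewrite dis outer_measure0 add0e -(nu_cone Ts); apply: le_outer_measure.
exact: subDsetl.
Qed.

Let P (B : set (borel T)) : \bar R := nu B.

Let borel_cara (B : set (borel T)) : measurable B -> nu.-caratheodory B.
Proof.
move=> mB; suff : (measurable : set (set (caratheodory_type nu))) B by [].
move: B mB; apply: smallest_sub; first exact: sigma_algebra_measurable.
move=> U /open_coneP[S ST ->]; rewrite bigcup_set_type.
apply: countable_bigcupT_measurable; last first.
  by move=> [t St]; apply: cone_cara; apply: ST; exact: set_mem St.
rewrite (eq_countable (card_setT _)).
by apply: sub_countable (tree_countable T); exact: subset_card_le.
Qed.

Let P0 : P set0 = 0. Proof. exact: outer_measure0. Qed.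
Let P_ge0 B : 0 <= P B. Proof. exact: outer_measure_ge0. Qed.
Let P_sigma_additive : semi_sigma_additive P.
Proof.
move=> F mF tF mUF.
apply: (@caratheodory_measure_sigma_additive R _ nu F) => //; last exact: borel_cara.
by move=> i; exact: borel_cara.
Qed.

HB.instance Definition _ := isMeasure.Build _ (borel T) R P P0 P_ge0
  P_sigma_additive.

Let P_setT : P setT = 1.
Proof.
rewrite /P -(indw_nil iw) -(nu_cone (tree_nil T)); congr (nu _).
by apply/seteqP; split=> // -[[[]|f] bx].
Qed.

HB.instance Definition _ := Measure_isProbability.Build _ _ _ P P_setT.

Lemma branch_probability : exists p : probability (borel T) R,
  forall t, node T t -> p (cone T t) = w t.
Proof. by exists P. Qed.

End existence.

Section positive_part.
Context {A : choiceType} {R : realType} (T : ctree A) (w : seq A -> \bar R).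
Hypothesis iw : indw T w.
Implicit Types s t : seq A.

Let pos : set (seq A) := node T `\` [set t | node T t /\ w t = 0].

Let posP t : pos t <-> node T t /\ w t <> 0.
Proof.
split=> [[Tt nt]|[Tt wt]]; split=> //; last by move=> [].
by move=> wt0; apply: nt.
Qed.

Let pos_neq0 : pos !=set0.
Proof.
exists [::]; apply/posP; split; first exact: tree_nil.
by rewrite (indw_nil iw) => /eqP; rewrite onee_eq0.
Qed.

Let pos_closed s t : prefix s t -> pos t -> pos s.
Proof.
move=> st /posP[Tt wt]; apply/posP; split; first exact: tree_closed Tt.
move=> ws; apply: wt; apply/eqP; rewrite eq_le (indw_ge0 iw) andbT.
by rewrite -ws; apply: (indw_le iw).
Qed.

Let pos_countable : countable pos.
Proof.
apply: sub_countable (tree_countable T).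
by apply: subset_card_le => t [].
Qed.

(* T minus the nodes of weight 0. *)
Definition pos_tree : ctree A := CTree pos_neq0 pos_closed pos_countable.

Lemma pos_nodeP t : node pos_tree t <-> node T t /\ w t <> 0.
Proof. exact: posP. Qed.

Lemma pos_sub : node pos_tree `<=` node T.
Proof. by move=> t []. Qed.

Lemma pos_succP t s : succ pos_tree t s <-> succ T t s /\ w s <> 0.
Proof.
split; first by move=> [/posP[Ts ws] ts sz]; split=> //; split.
by move=> [[Ts ts sz] ws]; split=> //; apply/posP.
Qed.

Lemma pos_inner t : inner pos_tree t -> inner T t.
Proof.
move=> it; have [s /pos_succP[st _]] := succ_neq0 it.
exact: succ_inner st.
Qed.

Lemma pos_indw : indw pos_tree w.
Proof.
split; [exact: indw_ge0 iw|exact: indw_nil iw|move=> t it].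
rewrite -(indw_succ iw (pos_inner it)) esum_mkcond [RHS]esum_mkcond.
apply: eq_esum => s _; case: ifPn => [/set_mem/pos_succP[st _]|nst].
  by rewrite mem_set.
case: ifPn => // /set_mem st; apply/esym/eqP; apply: contraNT nst => /eqP ws.
by apply: mem_set; apply/pos_succP.
Qed.

End positive_part.

Section null_union.
Context d (M : measurableType d) (R : realType) (m : {measure set M -> \bar R}).

Lemma measure_bigcup_null (I : choiceType) (S : set I) (F : I -> set M) :
  countable S -> (forall i, S i -> measurable (F i)) ->
  (forall i, S i -> m (F i) = 0) -> m (\bigcup_(i in S) F i) = 0.
Proof.
move=> /countable_injP[f finj] mF F0.
pose G n := \bigcup_(i in S `&` f @^-1` [set n]) F i.
have G0 n : measurable (G n) /\ m (G n) = 0.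
  have [[i Si <-]|nS] := pselect ((f @` S) n).
    suff -> : G (f i) = F i by split; [exact: mF|exact: F0].
    apply/seteqP; split=> [x [j [Sj /= fji] Fjx]|x Fix]; last by exists i.
    by rewrite -(finj _ _ _ _ fji) ?inE.
  suff -> : G n = set0 by split; rewrite ?measure0.
  apply/seteqP; split=> // x [i [Si fi] _].
  by apply: nS; exists i.
have UG : \bigcup_(i in S) F i = \bigcup_n G n.
  apply/seteqP; split=> x; last by move=> [n _ [i [Si _] Fx]]; exists i.
  by move=> [i Si Fx]; exists (f i) => //; exists i.
have mU : measurable (\bigcup_n G n).
  by apply: bigcupT_measurable => n; have [] := G0 n.
apply/eqP; rewrite UG eq_le measure_ge0 andbT.
apply: le_trans (generalized_Boole_inequality m _ mU) _.
  by move=> n; have [] := G0 n.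
by rewrite eseries0 // => n _ _; have [] := G0 n.
Qed.

End null_union.

Section collections.
Variables (R : realType) (A : choiceType).
Implicit Types s t : seq A.

(* [succ_neq0 it] proves succ t nonempty: each mu_t is a probability measure on
   all subsets of succ t. *)
Record TP := MkTP {
  tp_tree : ctree A;
  tp_mu : forall t (it : inner tp_tree t),
    probability (discr (succ_neq0 it)) R }.

Record IP := MkIP {
  ip_tree : ctree A;
  ip_mu : {measure set (discr (tree_neq0 ip_tree)) -> \bar R};
  ip_nil : ip_mu [set x | val x = [::]] = 1;
  ip_succ : forall t, inner ip_tree t ->
    ip_mu [set x | succ ip_tree t (val x)] = ip_mu [set x | val x = t] }.

(* A measure is a function on all sets, of which only the values on measurable
   sets are specified: bp_out sets the others to 0, so that an element of BP is
   determined by its values on B([T]). *)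
Record BP := MkBP {
  bp_tree : ctree A;
  bp_mu : probability (borel bp_tree) R;
  bp_out : forall B, ~ measurable B -> bp_mu B = 0 }.

(* Xi({t}); ip_mu X is a measure on all subsets of ip_tree X. *)
Definition ip_w (X : IP) t : \bar R := ip_mu X [set x | val x = t].

(* lambda([t]) *)
Definition bp_w (l : BP) t : \bar R := bp_mu l (cone (bp_tree l) t).

(* mu_t(B), and 0 when t is not a non-maximal node. *)
Definition tp_val (m : TP) t (B : set (seq A)) : \bar R :=
  match pselect (inner (tp_tree m) t) with
  | left it => tp_mu it [set x | B (val x)]
  | right _ => 0
  end.

(* prod_(k < |t|) mu_(t|k)({t|(k+1)}) *)
Definition tp_w (m : TP) t : \bar R :=
  \big[mule/1]_(k < size t) tp_val m (take k t) [set take k.+1 t].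

Lemma tp_valE (m : TP) t (it : inner (tp_tree m) t) B :
  tp_val m t B = tp_mu it [set x | B (val x)].
Proof.
rewrite /tp_val; case: pselect => // it'.
by rewrite (Prop_irrelevance it' it).
Qed.

Lemma tp_val_ge0 m t B : 0 <= tp_val m t B.
Proof. by rewrite /tp_val; case: pselect. Qed.

Lemma tp_val_fin m t B : tp_val m t B \is a fin_num.
Proof. by rewrite /tp_val; case: pselect => // it; rewrite fin_num_measure. Qed.

Lemma tp_w_ge0 m t : 0 <= tp_w m t.
Proof.
rewrite /tp_w; apply: (big_ind (fun x => 0 <= x)) => // [x y|k _].
  exact: mule_ge0.
exact: tp_val_ge0.
Qed.

Lemma tp_w_fin m t : tp_w m t \is a fin_num.
Proof.
rewrite /tp_w; apply: (big_ind (fun x => x \is a fin_num)) => // [x y|k _].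
  exact: fin_numM.
exact: tp_val_fin.
Qed.

Lemma tp_w_rcons m t a :
  tp_w m (rcons t a) = tp_w m t * tp_val m t [set rcons t a].
Proof.
rewrite /tp_w size_rcons big_ord_recr /=; congr (_ * _).
  apply: eq_bigr => k _; have kt := ltn_ord k.
  by rewrite -cats1 !takel_cat // ltnW.
by rewrite -cats1 take_size_cat // take_oversize // size_cat addn1.
Qed.

Lemma tp_val_esum m t B : inner (tp_tree m) t -> B `<=` succ (tp_tree m) t ->
  tp_val m t B = \esum_(s in B) tp_val m t [set s].
Proof.
move=> it BS; rewrite (tp_valE it) discr_measureE //; last first.
  apply: sub_countable (tree_countable (tp_tree m)); apply: subset_card_le.
  exact: succ_sub.
by apply: eq_esum => s _; rewrite (tp_valE it).
Qed.

Lemma tp_val_setT m t : inner (tp_tree m) t ->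
  tp_val m t (succ (tp_tree m) t) = 1.
Proof.
move=> it; rewrite (tp_valE it) -(@probability_setT _ _ _ (tp_mu it)).
congr (tp_mu it _); apply/seteqP; split=> // x _.
exact: set_mem (valP x).
Qed.

Lemma tp_indw m : indw (tp_tree m) (tp_w m).
Proof.
split; [exact: tp_w_ge0|by rewrite /tp_w big_ord0|move=> t it].
have r0 : (0 <= fine (tp_w m t))%R by rewrite fine_ge0 // tp_w_ge0.
have wr : tp_w m t = (NngNum r0)%:num%:E by rewrite /= fineK ?tp_w_fin.
move: (NngNum r0) wr => r wr; rewrite [RHS]wr.
pose mu := mscale r (tp_mu it).
transitivity (mu [set x | succ (tp_tree m) t (val x)]).
  apply: etrans; last first.
    apply/esym/(discr_measureE mu (C := succ (tp_tree m) t)) => //.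
    apply: sub_countable (tree_countable (tp_tree m)); apply: subset_card_le.
    exact: succ_sub.
  apply: eq_esum => s st; have [a ->] := succP st.
  by rewrite tp_w_rcons (tp_valE it) wr.
transitivity (r%:num%:E * tp_val m t (succ (tp_tree m) t)).
  by rewrite (tp_valE it).
by rewrite tp_val_setT // mule1.
Qed.

Lemma ip_indw (X : IP) : indw (ip_tree X) (ip_w X).
Proof.
split; [by move=> t; exact: measure_ge0|exact: ip_nil|move=> t it].
rewrite /ip_w -(ip_succ it) [RHS]discr_measureE //; first exact: tree_countable.
exact: succ_sub.
Qed.

Lemma bp_indw (l : BP) : indw (bp_tree l) (bp_w l).
Proof.
split; first by move=> t; exact: measure_ge0.
  rewrite /bp_w -(@probability_setT _ _ _ (bp_mu l)); congr (bp_mu l _).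
  by apply/seteqP; split=> // -[[[]|f] bx].
move=> t it; rewrite /bp_w -measure_esum.
- congr (bp_mu l _); apply/seteqP; split; last exact: cone_succ.
  by move=> x [s [_ ts _]]; exact: initseg_prefix.
- apply: sub_countable (tree_countable (bp_tree l)); apply: subset_card_le.
  exact: succ_sub.
- by move=> s [Ts _ _]; exact: measurable_cone.
move=> s u [_ _ zs] [_ _ zu] [x [sx ux]].
have /orP[] := initseg_total sx ux; rewrite prefixE.
  by rewrite zs -zu take_size => /eqP ->.
by rewrite zu -zs take_size => /eqP ->.
Qed.

Section of_probability.
Variables (T : ctree A) (p : probability (borel T) R).

Definition on_borel (B : set (borel T)) : \bar R :=
  if `[< measurable B >] then p B else 0.

Lemma on_borelE B : measurable B -> on_borel B = p B.
Proof. by move=> mB; rewrite /on_borel asboolT. Qed.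

Let on_borel0 : on_borel set0 = 0.
Proof. by rewrite on_borelE ?measure0. Qed.

Let on_borel_ge0 B : 0 <= on_borel B.
Proof. by rewrite /on_borel; case: asboolP. Qed.

Let on_borel_sigma_additive : semi_sigma_additive on_borel.
Proof.
move=> F mF tF mUF; rewrite on_borelE //.
rewrite (_ : (fun n => _) = fun n => \sum_(0 <= i < n) p (F i)).
  exact: measure_semi_sigma_additive.
by apply/funext => n; apply: eq_bigr => i _; rewrite on_borelE.
Qed.

HB.instance Definition _ := isMeasure.Build _ (borel T) R on_borel
  on_borel0 on_borel_ge0 on_borel_sigma_additive.

Let on_borel_setT : on_borel setT = 1.
Proof. by rewrite on_borelE // probability_setT. Qed.

HB.instance Definition _ := Measure_isProbability.Build _ _ _
  on_borel on_borel_setT.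

Lemma on_borel_out B : ~ measurable B -> on_borel B = 0.
Proof. by move=> mB; rewrite /on_borel asboolF. Qed.

Definition bp_of_probability : BP := MkBP on_borel_out.

Lemma bp_w_of_probability t :
  node T t -> bp_w bp_of_probability t = p (cone T t).
Proof. by move=> /measurable_cone; exact: on_borelE. Qed.

End of_probability.

Section of_weights.
Variables (T : ctree A) (w : seq A -> \bar R) (iw : indw T w).

Lemma pmass_indw_nil :
  pmass (tree_neq0 T) (indw_ge0 iw) [set x | val x = [::]] = 1.
Proof. by rewrite pmass1 ?(indw_nil iw) //; exact: tree_nil. Qed.

Lemma pmass_indw_succ t : inner T t ->
  pmass (tree_neq0 T) (indw_ge0 iw) [set x | succ T t (val x)] =
  pmass (tree_neq0 T) (indw_ge0 iw) [set x | val x = t].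
Proof.
move=> it; have [Tt _] := it; rewrite pmass1 // pmass_val ?(indw_succ iw) //.
exact: succ_sub.
Qed.

(* The measure on P(T) with Xi({t}) = w t. *)
Definition ip_of_weights : IP := MkIP pmass_indw_nil pmass_indw_succ.

Lemma ip_w_of_weights t : node T t -> ip_w ip_of_weights t = w t.
Proof. by move=> Tt; exact: pmass1. Qed.

End of_weights.

Definition Pi (m : TP) : IP := ip_of_weights (tp_indw m).

Definition Psi (l : BP) : IP := ip_of_weights (bp_indw l).

(* The choice is immaterial by branch_probability_unique. *)
Definition Lambda (m : TP) : BP :=
  bp_of_probability (projT1 (cid (branch_probability (tp_indw m)))).

Lemma LambdaE m t : node (tp_tree m) t -> bp_w (Lambda m) t = tp_w m t.
Proof.
move=> Tt; rewrite bp_w_of_probability //.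
exact: (projT2 (cid (branch_probability (tp_indw m)))).
Qed.

Lemma PiE m t : node (tp_tree m) t -> ip_w (Pi m) t = tp_w m t.
Proof. exact: ip_w_of_weights. Qed.

Lemma PsiE l t : node (bp_tree l) t -> ip_w (Psi l) t = bp_w l t.
Proof. exact: ip_w_of_weights. Qed.

Definition ip_N (X : IP) : set (seq A) :=
  [set t | node (ip_tree X) t /\ ip_w X t = 0].

(* T+_X, T+_m and T+_l *)
Definition ip_pos (X : IP) : ctree A := pos_tree (ip_indw X).
Definition tp_pos (m : TP) : ctree A := ip_pos (Pi m).
Definition bp_pos (l : BP) : ctree A := pos_tree (bp_indw l).

Section ip_plus.
Variable X : IP.
Let mu := mrestrict (tree_neq0 (ip_pos X)) (ip_mu X).

Lemma ip_plus_nil : mu [set x | val x = [::]] = 1.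
Proof.
rewrite /mu (mrestrict_val _ [set [::]]); first exact: ip_nil.
by move=> _ ->; exact: tree_nil.
Qed.

Lemma ip_plus_succ t : inner (ip_pos X) t ->
  mu [set x | succ (ip_pos X) t (val x)] = mu [set x | val x = t].
Proof.
move=> it; rewrite /mu mrestrict_val; last exact: succ_sub.
rewrite discr_measureE; last 2 first.
- exact: tree_countable.
- by move=> s /succ_sub; exact: pos_sub.
rewrite -[LHS]/(\esum_(s in succ (ip_pos X) t) ip_w X s).
rewrite (indw_succ (pos_indw (ip_indw X)) it).
rewrite (mrestrict_val _ [set t]) // => _ ->.
by case: it.
Qed.

Definition ip_plus : IP := MkIP ip_plus_nil ip_plus_succ.

End ip_plus.
End collections.

Section branch_restriction.
Variables (R : realType) (A : choiceType) (T T' : ctree A).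
Hypothesis T'T : node T' `<=` node T.

Let lift (B : set (branch T')) : set (branch T) := val @^-1` (val @` B).

Lemma branch_sub_setT : val @^-1` (val @` [set: branch T']) =
  ~` \bigcup_(t in node T `\` node T') cone T t.
Proof.
have bodyP x : body T x ->
    (body T' x <-> ~ exists2 t, node T t /\ ~ node T' t & initseg t x).
  move=> Tx; split=> [T'x [t [_ nt] tx]|nex].
    apply: nt; case: T'x tx => [[s [T's _] <-]|[f lf <-]] /=.
      by move=> ts; exact: tree_closed T's.
    by move=> /eqP ->.
  case: Tx nex => [[s [Ts sE] <-]|[f lf <-]] nex.
    have T's : node T' s.
      by apply: contrapT => ns; apply: nex; exists s => //=; exact: prefix_refl.
    left; exists s => //; split=> //; apply/seteqP; split=> // u [T'u su zu].
    by rewrite -sE; split=> //; exact: T'T.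
  right; exists f => // n; apply: contrapT => nn; apply: nex.
  by exists (mkseq f n) => //=; rewrite size_mkseq.
apply/seteqP; split=> x.
  move=> [y _ yx] [t [Tt nt] tx]; have := set_mem (valP y).
  rewrite yx => /(bodyP _ (set_mem (valP x))); apply.
  by exists t.
move=> nx; have bx : body T' (val x).
  apply/(bodyP _ (set_mem (valP x))) => -[t [Tt nt] tx]; apply: nx.
  by exists t.
by exists (SigSub (mem_set bx)).
Qed.

Lemma measurable_branch_sub (B : set (borel T')) : measurable B ->
  measurable (val @^-1` (val @` B) : set (borel T)).
Proof.
have inj (x y : branch T') : val x = val y -> x = y by exact: val_inj.
have mliftT : measurable (lift setT : set (borel T)).
  rewrite /lift branch_sub_setT; apply: measurableC; apply: sub_sigma_algebra.
  by apply: bigcup_open => t [Tt _]; exact: open_cone.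
apply: (@smallest_sub _ (sigma_algebra setT) open
  [set B | measurable (lift B : set (borel T))]).
  split=> [|C mC|F mF] /=.
  - by rewrite /lift image_set0 preimage_set0.
  - rewrite (_ : lift _ = lift setT `\` lift C); first exact: measurableD.
    apply/seteqP; split=> x.
      move=> [y [_ nC] yx]; split; first by exists y.
      by move=> [z Cz zx]; apply: nC; rewrite -(inj z y) // zx.
    move=> [[y _ yx] nC]; exists y => //; split=> // Cy; apply: nC.
    by exists y.
  - by rewrite /lift image_bigcup preimage_bigcup; exact: bigcupT_measurable.
move=> U /open_coneP[S ST' ->] /=.
rewrite (_ : lift _ = lift setT `&` \bigcup_(t in S) cone T t); last first.
  apply/seteqP; split=> x.
    move=> [y [t St ty] yx]; split; first by exists y.
    by exists t => //; rewrite /cone /mkset -yx.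
  move=> [[y _ yx] [t St tx]]; exists y => //; exists t => //.
  by rewrite /cone /mkset yx.
apply: measurableI => //; apply: sub_sigma_algebra.
by apply: bigcup_open => t St; apply: open_cone; apply: T'T; exact: ST'.
Qed.

Variable m : {measure set (borel T) -> \bar R}.

(* The restriction to B([T']) of a measure on B([T]). *)
Definition brestrict & node T' `<=` node T := fun B : set (borel T') =>
  m (val @^-1` (val @` B)).

Let brestrict0 : brestrict T'T set0 = 0.
Proof. by rewrite /brestrict image_set0 preimage_set0 measure0. Qed.

Let brestrict_ge0 B : 0 <= brestrict T'T B.
Proof. exact: measure_ge0. Qed.

Let brestrict_sigma_additive : semi_sigma_additive (brestrict T'T).
Proof.
move=> F mF tF mUF; rewrite /brestrict image_bigcup preimage_bigcup.
apply: measure_semi_sigma_additive.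
- by move=> i; exact: measurable_branch_sub.
- move=> i j _ _ [x [[y Fy yx] [z Fz zx]]]; apply: (tF i j) => //.
  exists y; split=> //; suff -> : y = z by [].
  by apply: val_inj; rewrite yx.
by apply: bigcupT_measurable => i; exact: measurable_branch_sub.
Qed.

HB.instance Definition _ := isMeasure.Build _ (borel T') R (brestrict T'T)
  brestrict0 brestrict_ge0 brestrict_sigma_additive.

End branch_restriction.

Section positive_parts.
Variables (R : realType) (A : choiceType).
Implicit Types s t : seq A.
Local Notation TP := (TP R A).
Local Notation IP := (IP R A).
Local Notation BP := (BP R A).

Section tp_plus.
Variable m : TP.

Lemma tp_inner t : inner (tp_pos m) t -> inner (tp_tree m) t.
Proof. exact: pos_inner. Qed.

Lemma tp_pos_nodeP t :
  node (tp_pos m) t <-> node (tp_tree m) t /\ tp_w m t <> 0.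
Proof.
split=> [/pos_nodeP[Tt]|[Tt wt]]; first by rewrite PiE.
by apply/pos_nodeP; split=> //; rewrite PiE.
Qed.

Definition tp_plus_mu t (it : inner (tp_pos m) t) :=
  mrestrict (succ_neq0 it) (tp_mu (tp_inner it)).
Arguments tp_plus_mu {t} it B.

Section tp_plus_mu.
Variables (t : seq A) (it : inner (tp_pos m) t).

HB.instance Definition _ := Measure.copy (tp_plus_mu it)
  (mrestrict (succ_neq0 it) (tp_mu (tp_inner it))).

Lemma tp_plus_muE C : C `<=` succ (tp_pos m) t ->
  tp_plus_mu it [set x | C (val x)] = tp_val m t C.
Proof. by move=> CS; rewrite (tp_valE (tp_inner it)); exact: mrestrict_val. Qed.

Let tp_plus_setT : tp_plus_mu it setT = 1.
Proof.
have iT := tp_inner it.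
have sT : succ (tp_pos m) t `<=` succ (tp_tree m) t.
  by move=> s [Ts ts zs]; split=> //; exact: pos_sub Ts.
rewrite (_ : setT = [set x | succ (tp_pos m) t (val x)]); last first.
  by apply/seteqP; split=> // x _; exact: set_mem (valP x).
rewrite tp_plus_muE // tp_val_esum // -(tp_val_setT iT) tp_val_esum //.
rewrite esum_mkcond [RHS]esum_mkcond; apply: eq_esum => s _.
case: ifPn => [/set_mem/sT st|nst]; first by rewrite mem_set.
case: ifPn => // /set_mem st; apply/esym/eqP; apply: contraNT nst => /eqP ws.
have [Ts ts zs] := st; apply: mem_set; split=> //; apply/tp_pos_nodeP.
split=> //; have [a sE] := succP st; move: ws; rewrite sE tp_w_rcons => ws.
move=> /eqP; rewrite mule_eq0 => /orP[/eqP wt|/eqP //].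
by have [/tp_pos_nodeP[_ /(_ wt)]] := it.
Qed.

HB.instance Definition _ := Measure_isProbability.Build _ _ _
  (tp_plus_mu it) tp_plus_setT.

End tp_plus_mu.

Definition tp_plus : TP :=
  @MkTP R A (tp_pos m) (fun t it => tp_plus_mu it).

End tp_plus.

Section bp_plus.
Variable l : BP.

Let sub : node (bp_pos l) `<=` node (bp_tree l).
Proof. exact: pos_sub. Qed.

Definition bp_plus_mu := brestrict (bp_mu l) sub.

HB.instance Definition _ := Measure.copy bp_plus_mu (brestrict (bp_mu l) sub).


Let null : set (borel (bp_tree l)) :=
  \bigcup_(t in node (bp_tree l) `\` node (bp_pos l)) cone (bp_tree l) t.

Let measurable_null : measurable null.
Proof.
by apply: sub_sigma_algebra; apply: bigcup_open => t [Tt _]; exact: open_cone.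
Qed.

Let null0 : bp_mu l null = 0.
Proof.
apply: measure_bigcup_null => [|t [Tt _]|t [Tt nt]].
- apply: sub_countable (tree_countable (bp_tree l)); apply: subset_card_le.
  by move=> t [].
- exact: measurable_cone.
by apply: contrapT => wt; apply: nt; apply/pos_nodeP.
Qed.

Let bp_plus_setT : bp_plus_mu setT = 1.
Proof.
have := probability_setC (bp_mu l) measurable_null; rewrite null0 sube0 => <-.
by rewrite /bp_plus_mu /brestrict branch_sub_setT.
Qed.

HB.instance Definition _ := Measure_isProbability.Build _ _ _
  bp_plus_mu bp_plus_setT.

Definition bp_plus : BP := @bp_of_probability R A (bp_pos l) bp_plus_mu.

Lemma bp_plusE t : node (bp_pos l) t -> bp_w bp_plus t = bp_w l t.
Proof.
move=> Pt; have /pos_nodeP[Tt _] := Pt; rewrite bp_w_of_probability //.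
rewrite /= /bp_plus_mu /brestrict.
have -> : val @^-1` (val @` cone (bp_pos l) t) =
    cone (bp_tree l) t `&` val @^-1` (val @` [set: branch (bp_pos l)]).
  apply/seteqP; split=> x.
    move=> [y ty yx]; split; last by exists y.
    by rewrite /cone /mkset -yx.
  move=> [tx [y _ yx]]; exists y => //.
  by rewrite /cone /mkset yx.
rewrite branch_sub_setT // -setDE -/null.
have mc := measurable_cone Tt.
rewrite [RHS](measureDI (bp_mu l) mc measurable_null).
rewrite [X in _ = _ + X](_ : _ = 0) ?adde0 //.
apply/eqP; rewrite eq_le measure_ge0 andbT -[leRHS]null0.
by apply: le_measure; rewrite ?inE //; exact: measurableI.
Qed.

End bp_plus.
End positive_parts.

Section diagram.
Variables (R : realType) (A : choiceType).
Implicit Types s t : seq A.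
Local Notation TP := (TP R A).
Local Notation IP := (IP R A).
Local Notation BP := (BP R A).

Record GP := MkGP {
  gp_ip : IP;
  gp_nu : forall t (it : inner (ip_tree gp_ip) t), ip_N gp_ip t ->
    probability (discr (succ_neq0 it)) R }.

Section conditional.
Variables (X : IP) (t : seq A) (it : inner (ip_tree X) t).
Hypothesis nt : ~ ip_N X t.

(* For t not in N_X, the measure s |-> X({s}) / X({t}) on P(succ t). *)
Definition ip_cond & ~ ip_N X t := fun B : set (discr (succ_neq0 it)) =>
  ip_mu X (val @^-1` (val @` B)) / ip_w X t.

Let fin_t : ip_w X t \is a fin_num.
Proof. by apply: (indw_fin (ip_indw X)); case: it. Qed.

Let neq0_t : ip_w X t != 0.
Proof. by apply/eqP => wt; apply: nt; split=> //; case: it. Qed.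

Let ip_condE : exists r : {nonneg R},
  ip_cond nt = mscale r (mrestrict (succ_neq0 it) (ip_mu X)).
Proof.
have r0 : (0 <= (fine (ip_w X t))^-1)%R.
  by rewrite invr_ge0 fine_ge0 // (indw_ge0 (ip_indw X)).
exists (NngNum r0); apply/funext => B; rewrite /ip_cond /mscale /= muleC.
congr (_ * _); rewrite -[in LHS](fineK fin_t) inver fine_eq0 //.
by rewrite (negbTE neq0_t).
Qed.

Let ip_cond0 : ip_cond nt set0 = 0.
Proof. by have [r ->] := ip_condE; exact: measure0. Qed.

Let ip_cond_ge0 B : 0 <= ip_cond nt B.
Proof. by have [r ->] := ip_condE; exact: measure_ge0. Qed.

Let ip_cond_sigma_additive : semi_sigma_additive (ip_cond nt).
Proof. by have [r ->] := ip_condE; exact: measure_semi_sigma_additive. Qed.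

HB.instance Definition _ := isMeasure.Build _ (discr (succ_neq0 it)) R
  (ip_cond nt) ip_cond0 ip_cond_ge0 ip_cond_sigma_additive.

Let ip_cond_setT : ip_cond nt setT = 1.
Proof.
rewrite /ip_cond (_ : val @^-1` _ = [set x | succ (ip_tree X) t (val x)]).
  by rewrite ip_succ // divee.
apply/seteqP; split=> x /=; first by move=> [y _ <-]; exact: set_mem (valP y).
by move=> sx; exists (SigSub (mem_set sx)).
Qed.

HB.instance Definition _ := Measure_isProbability.Build _ _ _
  (ip_cond nt) ip_cond_setT.

End conditional.
Arguments ip_cond {X t} it nt B.

Definition Delta (e : GP) : TP := @MkTP R A (ip_tree (gp_ip e))
  (fun t it => match pselect (ip_N (gp_ip e) t) with
               | left nt => gp_nu it nt
               | right nt => ip_cond it nt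
               end).

Definition tp_positive (m : TP) := forall t (it : inner (tp_tree m) t) s,
  succ (tp_tree m) t s -> 0 < tp_mu it [set x | val x = s].
Definition ip_positive (X : IP) := forall t, node (ip_tree X) t ->
  0 < ip_mu X [set x | val x = t].
Definition bp_positive (l : BP) := forall t, node (bp_tree l) t ->
  0 < bp_mu l (cone (bp_tree l) t).

Definition TPp := {m : TP | tp_positive m}.
Definition IPp := {X : IP | ip_positive X}.
Definition BPp := {l : BP | bp_positive l}.

Lemma tp_plus_positive m : tp_positive (tp_plus m).
Proof.
move=> t it s st; have sub : [set s] `<=` succ (tp_pos m) t by move=> _ ->.
have -> : tp_mu it [set x | val x = s] = tp_val m t [set s].
  exact: (tp_plus_muE it sub).
rewrite lt_neqAle tp_val_ge0 andbT eq_sym; apply/eqP => v0.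
have [/tp_pos_nodeP[_ ws] _ _] := st; have [a sE] := succP st.
by apply: ws; rewrite sE tp_w_rcons -sE v0 mule0.
Qed.

Lemma ip_plus_positive X : ip_positive (ip_plus X).
Proof.
move=> t Pt; have sub : [set t] `<=` node (ip_pos X) by move=> _ ->.
have -> : ip_mu (ip_plus X) [set x | val x = t] = ip_w X t.
  exact: (mrestrict_val (ip_mu X) _ sub).
have /pos_nodeP[Tt /eqP wt] := Pt.
by rewrite lt_neqAle eq_sym wt (indw_ge0 (ip_indw X)).
Qed.

Lemma bp_plus_positive l : bp_positive (bp_plus l).
Proof.
move=> t Pt; rewrite -[ltRHS]/(bp_w (bp_plus l) t) bp_plusE //.
have /pos_nodeP[Tt /eqP wt] := Pt.
by rewrite lt_neqAle eq_sym wt (indw_ge0 (bp_indw l)).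
Qed.

Lemma tp_w_positive m : tp_positive m ->
  forall t, node (tp_tree m) t -> 0 < tp_w m t.
Proof.
move=> pm; elim/last_ind => [_|t a ih Ta].
  by rewrite /tp_w big_ord0.
have ss := succ_rcons Ta; have it := succ_inner ss.
rewrite tp_w_rcons mule_gt0 //; first by apply: ih; case: it.
by rewrite (tp_valE it); exact: pm.
Qed.

Lemma Pi_positive m : tp_positive m -> ip_positive (Pi m).
Proof.
move=> pm t Tt; rewrite -[ltRHS]/(ip_w (Pi m) t) PiE //.
exact: tp_w_positive.
Qed.

Lemma Lambda_positive m : tp_positive m -> bp_positive (Lambda m).
Proof.
move=> pm t Tt; rewrite -[ltRHS]/(bp_w (Lambda m) t) LambdaE //.
exact: tp_w_positive.
Qed.

Lemma Psi_positive l : bp_positive l -> ip_positive (Psi l).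
Proof.
by move=> pl t Tt; rewrite -[ltRHS]/(ip_w (Psi l) t) PsiE //; exact: pl.
Qed.

Definition phi_TP (m : TP) : TPp := exist _ _ (@tp_plus_positive m).
Definition phi_IP (X : IP) : IPp := exist _ _ (@ip_plus_positive X).
Definition phi_BP (l : BP) : BPp := exist _ _ (@bp_plus_positive l).

Definition Pi_plus (m : TPp) : IPp := exist _ _ (Pi_positive (svalP m)).
Definition Lambda_plus (m : TPp) : BPp := exist _ _ (Lambda_positive (svalP m)).
Definition Psi_plus (l : BPp) : IPp := exist _ _ (Psi_positive (svalP l)).

Lemma IP_eq (X Y : IP) : ip_tree X = ip_tree Y ->
  (forall t, node (ip_tree X) t -> ip_w X t = ip_w Y t) -> X = Y.
Proof.
case: X Y => [T mu n s] [T' mu' n' s'] /= E; case: _ / E in mu' n' s' *.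
rewrite /ip_w /= => wE; suff E : mu = mu'.
  case: _ / E in n' s' {wE} *; by congr MkIP; exact: Prop_irrelevance.
apply: eq_measure; apply/funext => B.
pose C : set (seq A) := val @` B.
have CT : C `<=` node T by move=> _ [x _ <-]; exact: set_mem (valP x).
have -> : B = [set x | C (val x)].
  apply/seteqP; split=> x; first by exists x.
  by move=> [y By /val_inj <-].
rewrite !discr_measureE //; do ?exact: tree_countable.
by apply: eq_esum => t /CT; exact: wE.
Qed.

Lemma Psi_plus_surj (X : IPp) : exists l : BPp, Psi_plus l = X.
Proof.
case: X => X pX; have [p pE] := branch_probability (ip_indw X).
have pp : bp_positive (bp_of_probability p).
  move=> t Tt; rewrite -[ltRHS]/(bp_w (bp_of_probability p) t).
  by rewrite bp_w_of_probability // pE //; exact: pX.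
exists (exist _ _ pp); apply: eq_exist; apply: IP_eq => //= t Tt.
by rewrite PsiE // bp_w_of_probability //; exact: pE.
Qed.

(* The inverse of the bijection [Psi_plus]. *)
Definition Psi_plus_inv (X : IPp) : BPp := projT1 (cid (Psi_plus_surj X)).

Lemma Psi_plus_invK : cancel Psi_plus_inv Psi_plus.
Proof. by move=> X; exact: projT2 (cid (Psi_plus_surj X)). Qed.

Definition gamma_GP (e : GP) : IP := gp_ip e.
Definition gamma_plus (e : GP) : IPp := phi_IP (gp_ip e).
Definition Delta_plus (e : GP) : TPp := phi_TP (Delta e).

HB.instance Definition _ := gen_eqMixin TP.
HB.instance Definition _ := gen_choiceMixin TP.
HB.instance Definition _ := gen_eqMixin IP.
HB.instance Definition _ := gen_choiceMixin IP.
HB.instance Definition _ := gen_eqMixin BP.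
HB.instance Definition _ := gen_choiceMixin BP.

End diagram.


Section quotients.
Variables (R : realType) (A : choiceType).
Local Notation TP := (TP R A).
Local Notation IP := (IP R A).
Local Notation BP := (BP R A).
Local Notation GP := (GP R A).
Local Notation TPp := (TPp R A).
Local Notation IPp := (IPp R A).
Local Notation BPp := (BPp R A).

Definition tp_equiv : rel TP := fun m n => `[< tp_plus m = tp_plus n >].
Definition ip_equiv : rel IP := fun X Y => `[< ip_plus X = ip_plus Y >].
Definition bp_equiv : rel BP := fun k l => `[< bp_plus k = bp_plus l >].

Lemma kernel_equiv (X Y : Type) (f : X -> Y) (e : rel X) :
  (forall x y, e x y = `[< f x = f y >]) -> equiv_class_of e.
Proof.
move=> eE; split=> [x|x y|y x z]; rewrite !eE; first exact/asboolP.
  by apply/asboolP/asboolP.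
by move=> /asboolP xy /asboolP yz; apply/asboolP; rewrite xy.
Qed.

Canonical tp_equiv_rel := EquivRelPack (kernel_equiv (fun _ _ => erefl) :
  equiv_class_of tp_equiv).
Canonical ip_equiv_rel := EquivRelPack (kernel_equiv (fun _ _ => erefl) :
  equiv_class_of ip_equiv).
Canonical bp_equiv_rel := EquivRelPack (kernel_equiv (fun _ _ => erefl) :
  equiv_class_of bp_equiv).

Definition TPq := {eq_quot tp_equiv}.
Definition IPq := {eq_quot ip_equiv}.
Definition BPq := {eq_quot bp_equiv}.

Definition pi_TP (m : TP) : TPq := \pi_TPq m.
Definition pi_IP (X : IP) : IPq := \pi_IPq X.
Definition pi_BP (l : BP) : BPq := \pi_BPq l.

Definition pi_TPp (m : TPp) : TPq := pi_TP (sval m).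
Definition pi_IPp (X : IPp) : IPq := pi_IP (sval X).
Definition pi_BPp (l : BPp) : BPq := pi_BP (sval l).

(* The maps induced on classes, computed on a chosen representative. *)
Definition Pi_hat (c : TPq) : IPq := pi_IP (Pi (repr c)).
Definition Psi_hat (c : BPq) : IPq := pi_IP (Psi (repr c)).
Definition Lambda_hat (c : TPq) : BPq := pi_BP (Lambda (repr c)).

Inductive vertex :=
| vGP | vTP | vIP | vBP | vTPp | vIPp | vBPp | vTPq | vIPq | vBPq.

Definition carrier (v : vertex) : Type :=
  match v with
  | vGP => GP
  | vTP => TP | vIP => IP | vBP => BP
  | vTPp => TPp | vIPp => IPp | vBPp => BPp
  | vTPq => TPq | vIPq => IPq | vBPq => BPq
  end.

Inductive arrow : vertex -> vertex -> Type :=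
| aPi : arrow vTP vIP
| aLambda : arrow vTP vBP
| aPsi : arrow vBP vIP
| aDelta : arrow vGP vTP
| agamma : arrow vGP vIP
| aDelta_plus : arrow vGP vTPp
| agamma_plus : arrow vGP vIPp
| aphi_TP : arrow vTP vTPp
| aphi_IP : arrow vIP vIPp
| aPi_plus : arrow vTPp vIPp
| aLambda_plus : arrow vTPp vBPp
| aPsi_plus_inv : arrow vIPp vBPp
| api_TP : arrow vTP vTPq
| api_IP : arrow vIP vIPq
| api_TPp : arrow vTPp vTPq
| api_IPp : arrow vIPp vIPq
| api_BPp : arrow vBPp vBPq
| aPi_hat : arrow vTPq vIPq
| aLambda_hat : arrow vTPq vBPq
| aPsi_hat : arrow vBPq vIPq.

Definition arrow_map u v (a : arrow u v) : carrier u -> carrier v :=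
  match a in arrow u v return carrier u -> carrier v with
  | aPi => @Pi R A
  | aLambda => @Lambda R A
  | aPsi => @Psi R A
  | aDelta => @Delta R A
  | agamma => @gamma_GP R A
  | aDelta_plus => @Delta_plus R A
  | agamma_plus => @gamma_plus R A
  | aphi_TP => @phi_TP R A
  | aphi_IP => @phi_IP R A
  | aPi_plus => @Pi_plus R A
  | aLambda_plus => @Lambda_plus R A
  | aPsi_plus_inv => @Psi_plus_inv R A
  | api_TP => pi_TP
  | api_IP => pi_IP
  | api_TPp => pi_TPp
  | api_IPp => pi_IPp
  | api_BPp => pi_BPp
  | aPi_hat => Pi_hat
  | aLambda_hat => Lambda_hat
  | aPsi_hat => Psi_hat
  end.

Inductive dpath : vertex -> vertex -> Type :=
| dpath_arrow u v : arrow u v -> dpath u v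
| dpath_cons u v z : arrow u v -> dpath v z -> dpath u z.

Fixpoint dpath_map u v (p : dpath u v) : carrier u -> carrier v :=
  match p in dpath u v return carrier u -> carrier v with
  | dpath_arrow _ _ a => arrow_map a
  | dpath_cons _ _ _ a q => dpath_map q \o arrow_map a
  end.

End quotients.
Arguments dpath_map R A {u v} p _.

Definition surjective (X Y : Type) (f : X -> Y) := set_surj setT setT f.

(* Main.v *)
(** Sending an element to the positive part of the inductive measure it
    determines gives, for every vertex of the diagram, a map into IP+ that is
    invariant under all arrows.  On the vertices TP+, IP+, BP+ and the three
    quotients this map is a bijection, so there any two paths agree and every
    arrow between two of these vertices is bijective.  On GP, TP, IP and BP the
    inductive measure itself is invariant; it is the identity on IP and
    injective on BP, because an inductive measure is the trace on cones of a
    unique Borel measure.  The only path into TP is Delta, which is bijective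
    since a sequence of measures is recovered from its inductive measure at the
    nodes of positive weight. *)

Require Import Defs.
From mathcomp Require Import all_boot all_order all_algebra.
From mathcomp Require Import all_classical all_reals all_analysis.
From mathcomp Require Import generic_quotient.
Import Order.TTheory GRing.Theory Num.Theory.

(** * Equality of probabilities, trees and sequences of measures *)

Lemma eq_probability d (T : measurableType d) (R : realType)
    (p q : probability T R) : p = q :> (set T -> \bar R) -> p = q.
Proof.
case: p q => [p [[a b] [c] [k] [f] [g] [h] [i]]].
case=> [q [[a' b'] [c'] [k'] [f'] [g'] [h'] [i']]] /= E.
case: _ / E in a' b' c' k' f' g' h' i' *.
(* The type of [c'] mentions the proofs before it, so these are identified first. *)
rewrite (Prop_irrelevance a' a) (Prop_irrelevance b' b) in c' *.
rewrite (Prop_irrelevance c' c) (Prop_irrelevance k' k).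
rewrite (Prop_irrelevance f' f) (Prop_irrelevance g' g).
by rewrite (Prop_irrelevance h' h) (Prop_irrelevance i' i).
Qed.

Section diagram_theory.
Local Set Implicit Arguments.
Local Unset Strict Implicit.
Local Open Scope classical_set_scope.
Local Open Scope ereal_scope.
Context {R : realType} {A : choiceType}.
Implicit Types (s t : seq A) (m : TP R A) (X : IP R A) (l : BP R A) (e : GP R A).

Lemma ctree_eq (T T' : ctree A) : node T = node T' -> T = T'.
Proof.
case: T T' => [N n c d] [N' n' c' d'] /= E; case: _ / E in n' c' d' *.
by congr CTree; exact: Prop_irrelevance.
Qed.

Lemma discr_measure_eq (B : choiceType) (S : set B) (S0 : S !=set0)
    (p q : probability (discr S0) R) : countable S ->
  (forall x, S x -> p [set y | val y = x] = q [set y | val y = x]) -> p = q.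
Proof.
move=> cS pq; apply: eq_probability; apply/funext => C.
pose D : set B := val @` C.
have DS : D `<=` S by move=> _ [x _ <-]; exact: set_mem (valP x).
have -> : C = [set x | D (val x)].
  apply/seteqP; split=> x; first by exists x.
  by move=> [y Cy /val_inj <-].
by rewrite !discr_measureE //; apply: eq_esum => x /DS; exact: pq.
Qed.

Lemma countable_succ (T : ctree A) t : countable (succ T t).
Proof.
apply: sub_countable (tree_countable T); apply: subset_card_le.
exact: succ_sub.
Qed.

Lemma tp_val_MkTP (T : ctree A)
    (mu : forall t (it : inner T t), probability (discr (succ_neq0 it)) R)
    t (it : inner T t) (B : set (seq A)) :
  tp_val (MkTP mu) t B = mu t it [set x | B (val x)].
Proof. exact: (@tp_valE _ _ (MkTP mu) t it B). Qed.

(** [tp_val] takes sets of sequences, so the hypothesis needs no transport along the equality of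
    trees. *)
Lemma TP_eq m m' : tp_tree m = tp_tree m' ->
  (forall t s, succ (tp_tree m) t s -> tp_val m t [set s] = tp_val m' t [set s]) ->
  m = m'.
Proof.
case: m m' => [T mu] [T' mu'] /= E; case: _ / E in mu' * => vE.
congr MkTP; apply/functional_extensionality_dep => t.
apply/functional_extensionality_dep => it.
apply: discr_measure_eq => [|s st]; first exact: countable_succ.
by have := vE _ _ st; rewrite !(tp_val_MkTP _ it).
Qed.

(** * Inductive measures and Borel measures *)

Lemma Psi_inj : injective (@Psi R A).
Proof.
move=> l l' E; have T := congr1 (@ip_tree R A) E.
have wE t : node (bp_tree l) t -> bp_w l t = bp_w l' t.
  by move=> Tt; rewrite -!PsiE ?E // -[bp_tree l']T.
case: l l' T wE {E} => [T p out] [T' p' out'] /= E.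
case: _ / E in p' out' * => pE.
suff E : p = p' by case: _ / E in out' {pE} *; congr MkBP; exact: Prop_irrelevance.
apply: eq_probability; apply/funext => B.
(* Off the Borel sets both measures are 0 by [bp_out]; on them the cones decide. *)
have [mB|mB] := pselect (measurable B); last by rewrite out ?out'.
exact: branch_probability_unique.
Qed.

Lemma Psi_surj X : exists l, Psi l = X.
Proof.
have [p pE] := branch_probability (ip_indw X).
exists (bp_of_probability p); apply: IP_eq => //= t Tt.
by rewrite PsiE // bp_w_of_probability //; exact: pE.
Qed.

Lemma Psi_Lambda m : Psi (Lambda m) = Pi m.
Proof. by apply: IP_eq => //= t Tt; rewrite PsiE // LambdaE // PiE. Qed.

(** * Positive parts under [Pi] and [Psi] *)

Lemma ip_w_plus X t : node (ip_pos X) t -> ip_w (ip_plus X) t = ip_w X t.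
Proof.
by move=> Pt; apply: (mrestrict_val (ip_mu X) [set t]) => _ ->.
Qed.

Lemma tp_w_plus m t : node (tp_pos m) t -> tp_w (tp_plus m) t = tp_w m t.
Proof.
elim/last_ind: t => [|t a ih] Pta; first by rewrite /tp_w !big_ord0.
have st := succ_rcons Pta; have it := succ_inner st.
rewrite !tp_w_rcons ih; last by case: it.
congr (_ * _); rewrite (tp_val_MkTP _ it).
by apply: (tp_plus_muE it) => _ ->.
Qed.

Lemma Pi_tp_plus m : Pi (tp_plus m) = ip_plus (Pi m).
Proof.
apply: IP_eq => //= t Pt; rewrite PiE // tp_w_plus // ip_w_plus // PiE //.
by case/tp_pos_nodeP: Pt.
Qed.

Lemma Psi_bp_plus l : Psi (bp_plus l) = ip_plus (Psi l).
Proof.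
(* [bp_pos] is cut out by weights of cones, [ip_pos] by point masses; these agree on the nodes of
   the tree. *)
have PP t : node (bp_pos l) t <-> node (ip_pos (Psi l)) t.
  split=> /pos_nodeP[Tt wt]; apply/pos_nodeP; split=> //; move: wt.
    by rewrite PsiE.
  by rewrite PsiE.
apply: IP_eq => [|t Pt].
  by apply: ctree_eq; apply/seteqP; split=> t /PP.
rewrite PsiE // bp_plusE // ip_w_plus ?PsiE //; last exact/PP.
by case/pos_nodeP: Pt.
Qed.

Lemma ip_plus_id X : ip_positive X -> ip_plus X = X.
Proof.
move=> pX; apply: IP_eq => [|t Pt]; last exact: ip_w_plus.
apply: ctree_eq; apply/seteqP; split=> t; first exact: pos_sub.
by move=> Tt; apply/pos_nodeP; split=> // wt; have := pX _ Tt; rewrite -/(ip_w X t) wt ltxx.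
Qed.

(** * Recovering sequences of measures from weights *)

(** The quotients telescope along nodes of positive weight; below a null node both sides vanish,
    whatever [gp_nu] is. *)
Lemma tp_w_Delta e t : node (ip_tree (gp_ip e)) t ->
  tp_w (Delta e) t = ip_w (gp_ip e) t.
Proof.
elim/last_ind: t => [|t a ih] Tta.
  by rewrite /tp_w big_ord0 (indw_nil (ip_indw _)).
have st := succ_rcons Tta; have it := succ_inner st; have [Tt _] := it.
rewrite tp_w_rcons ih // (tp_val_MkTP _ it) /=.
case: pselect => [Nt|nt].
  have [_ wt] := Nt; rewrite wt mul0e; apply/eqP.
  rewrite eq_le (indw_ge0 (ip_indw _)) /=.
  by rewrite -wt; apply: (indw_le_succ (ip_indw _)).
rewrite /= /ip_cond (_ : val @^-1` _ = [set x | val x = rcons t a]); last first.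
  apply/seteqP; split=> x /=; first by move=> [y <- ->].
  by move=> xE; exists (SigSub (mem_set st)).
rewrite muleCA divee ?mule1 //; first exact: (indw_fin (ip_indw _)).
by apply/eqP => wt; apply: nt.
Qed.

Lemma Pi_Delta e : Pi (Delta e) = gp_ip e.
Proof. by apply: IP_eq => //= t Tt; rewrite PiE // tp_w_Delta. Qed.

(** Applying [Pi] recovers the inductive measure; the other data are read off at the null nodes,
    where [Delta] copies them. *)
Lemma Delta_inj : injective (@Delta R A).
Proof.
move=> e e' E; have := congr1 (@Pi R A) E; rewrite !Pi_Delta.
case: e e' E => [X nu] [X' nu'] E /= E'; case: _ / E' in nu' E *.
congr MkGP; apply/functional_extensionality_dep => t.
apply/functional_extensionality_dep => it.
apply/functional_extensionality_dep => nt.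
apply: discr_measure_eq => [|s st]; first exact: countable_succ.
have := congr1 (fun m => tp_val m t [set s]) E.
rewrite !(tp_val_MkTP _ it) /=.
by case: pselect => // nt'; rewrite (Prop_irrelevance nt' nt).
Qed.

Lemma tp_val_ratio m t a : tp_w m t <> 0 ->
  tp_val m t [set rcons t a] = (tp_w m t)^-1 * tp_w m (rcons t a).
Proof.
by move=> /eqP wt; rewrite tp_w_rcons muleA mulVe ?tp_w_fin // mul1e.
Qed.

Lemma Delta_surj m : exists e, Delta e = m.
Proof.
(* The measures of [m] are kept at null nodes; elsewhere equal weights give equal ratios. *)
pose e := @MkGP R A (Pi m) (fun t (it : inner (ip_tree (Pi m)) t) _ => tp_mu it).
have we t : node (tp_tree m) t -> tp_w (Delta e) t = tp_w m t.
  by move=> Tt; rewrite (@tp_w_Delta e t Tt) /= PiE.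
exists e; apply: TP_eq => //= t s st.
have it := succ_inner st; have [Tt _] := it; have [Ts _ _] := st.
have [wt|wt] := pselect (tp_w m t = 0).
  rewrite (tp_val_MkTP _ it) (tp_valE it) /=.
  by case: pselect => // -[]; split=> //; rewrite PiE.
have [a sE] := succP st; rewrite sE in Ts *.
by rewrite !tp_val_ratio ?we.
Qed.

Lemma gamma_surj X : exists e, gp_ip e = X.
Proof.
(* Any probability will do at a null node; a point mass exists because there are successors. *)
by exists (@MkGP R A X (fun t it _ => dirac (point : discr (succ_neq0 it)))).
Qed.

Lemma Pi_surj X : exists m, Pi m = X.
Proof. by have [e <-] := gamma_surj X; exists (Delta e); exact: Pi_Delta. Qed.

(** Without null nodes every transition probability is a ratio of weights. *)
Lemma Pi_inj_positive m m' : tp_positive m -> tp_positive m' ->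
  Pi m = Pi m' -> m = m'.
Proof.
move=> pm pm' E; have T := congr1 (@ip_tree R A) E.
have wE t : node (tp_tree m) t -> tp_w m t = tp_w m' t.
  by move=> Tt; rewrite -!PiE ?E // -[tp_tree m']T.
have w0 t : node (tp_tree m) t -> tp_w m t <> 0.
  by move=> Tt wt; have := tp_w_positive pm Tt; rewrite wt ltxx.
apply: TP_eq => // t s st; have [Ts _ _] := st.
have [Tt _] := succ_inner st; have [a sE] := succP st; rewrite sE in Ts *.
by rewrite !tp_val_ratio -?wE //; exact: w0.
Qed.

(** The edge into a node is the last factor of its weight, so it cannot vanish if the product is
    positive. *)
Lemma Pi_positive_inv m : ip_positive (Pi m) -> tp_positive m.
Proof.
move=> pm t it s st; have [Ts _ _] := st; have := pm s Ts.
rewrite -/(ip_w (Pi m) s) PiE //; have [a sE] := succP st.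
rewrite sE tp_w_rcons (tp_valE it) => w0.
rewrite lt_neqAle measure_ge0 andbT eq_sym; apply/eqP => v0.
by move: w0; rewrite [X in _ * X]v0 mule0 ltxx.
Qed.

(** It suffices to compare after [Pi], which is injective on positive sequences. *)
Lemma tp_plus_id m : tp_positive m -> tp_plus m = m.
Proof.
move=> pm; apply: Pi_inj_positive => //; first exact: tp_plus_positive.
by rewrite Pi_tp_plus ip_plus_id //; exact: Pi_positive.
Qed.

(** * Subtypes and quotients *)

Lemma sig_eq (B : Type) (P : B -> Prop) (x y : {b | P b}) :
  sval x = sval y -> x = y.
Proof. by case: x y => [x Px] [y Py]; exact: eq_exist. Qed.

Lemma bijective_of (B C : Type) (f : B -> C) :
  injective f -> (forall y, exists x, f x = y) -> bijective f.
Proof.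
move=> fi fs; rewrite -setTT_bijective; split=> // [x y _ _|y _]; first exact: fi.
by have [x] := fs y; exists x.
Qed.

Lemma tp_plus_repr m : tp_plus (repr (pi_TP m)) = tp_plus m.
Proof. by have /eqmodP/asboolP := reprK (pi_TP m). Qed.

Lemma ip_plus_repr X : ip_plus (repr (pi_IP X)) = ip_plus X.
Proof. by have /eqmodP/asboolP := reprK (pi_IP X). Qed.

Lemma bp_plus_repr l : bp_plus (repr (pi_BP l)) = bp_plus l.
Proof. by have /eqmodP/asboolP := reprK (pi_BP l). Qed.

Lemma TPq_eq (c c' : TPq R A) : tp_plus (repr c) = tp_plus (repr c') -> c = c'.
Proof.
move=> /asboolP E; rewrite -[c]reprK -[c']reprK; apply/eqmodP; exact: E.
Qed.

Lemma IPq_eq (c c' : IPq R A) : ip_plus (repr c) = ip_plus (repr c') -> c = c'.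
Proof.
move=> /asboolP E; rewrite -[c]reprK -[c']reprK; apply/eqmodP; exact: E.
Qed.

Lemma BPq_eq (c c' : BPq R A) : bp_plus (repr c) = bp_plus (repr c') -> c = c'.
Proof.
move=> /asboolP E; rewrite -[c]reprK -[c']reprK; apply/eqmodP; exact: E.
Qed.

(** * The invariant with values in IP+ *)

(* On the quotients a representative is chosen; positive_part_arrow shows that the
   choice is immaterial. *)
Definition positive_part v : carrier R A v -> IPp R A :=
  match v with
  | vGP => fun e => phi_IP (gp_ip e)
  | vTP => fun m => phi_IP (Pi m)
  | vIP => @phi_IP R A
  | vBP => fun l => phi_IP (Psi l)
  | vTPp => @Pi_plus R A
  | vIPp => id
  | vBPp => @Psi_plus R A
  | vTPq => fun c => phi_IP (Pi (repr c))
  | vIPq => fun c => phi_IP (repr c)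
  | vBPq => fun c => phi_IP (Psi (repr c))
  end.

(** These are the vertices at which [positive_part] is shown to be bijective. *)
Definition reduced v :=
  match v with vGP | vTP | vIP | vBP => false | _ => true end.

Lemma positive_part_arrow u v (a : arrow u v) x :
  positive_part (arrow_map a x) = positive_part x.
Proof.
have plus_sval (X : IPp R A) : ip_plus (sval X) = sval X.
  exact/ip_plus_id/svalP.
case: a x => /= x; apply: sig_eq => /=; rewrite ?Psi_Lambda ?Pi_Delta //.
- by rewrite Pi_tp_plus Pi_Delta.
- by rewrite Pi_tp_plus.
- by have /(congr1 sval) := Psi_plus_invK x.
(* From here on representatives occur. They are known only up to positive part, which commutes with
   [Pi] and [Psi]. *)
- by rewrite -Pi_tp_plus tp_plus_repr Pi_tp_plus.
- exact: ip_plus_repr.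
- rewrite -Pi_tp_plus tp_plus_repr Pi_tp_plus.
  by apply: ip_plus_id; apply: Pi_positive; exact: svalP.
- by rewrite ip_plus_repr plus_sval.
- rewrite -Psi_bp_plus bp_plus_repr Psi_bp_plus.
  by apply: ip_plus_id; apply: Psi_positive; exact: svalP.
- exact: ip_plus_repr.
- by rewrite -Psi_bp_plus bp_plus_repr Psi_bp_plus Psi_Lambda.
- exact: ip_plus_repr.
Qed.

Lemma positive_part_bij v : reduced v -> bijective (@positive_part v).
Proof.
have Pip_surj (X : IPp R A) : exists m : TPp R A, Pi_plus m = X.
  case: X => X pX; have [m mX] := Pi_surj X.
  have pm : tp_positive m by apply: Pi_positive_inv; rewrite mX.
  by exists (exist _ m pm); exact: sig_eq.
case: v => // _; apply: bijective_of => //=.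
- move=> [m pm] [m' pm'] /(congr1 sval) /= E.
  by apply: sig_eq; exact: Pi_inj_positive.
- by move=> X; exists X.
- by move=> l l' /(congr1 sval) /Psi_inj; exact: sig_eq.
- exact: Psi_plus_surj.
- move=> c c' /(congr1 sval) /=; rewrite -!Pi_tp_plus => E.
  by apply: TPq_eq; apply: Pi_inj_positive E; exact: tp_plus_positive.
(* The class of a positive preimage works, since the projection preserves [positive_part]. *)
- move=> X; have [m <-] := Pip_surj X; exists (pi_TPp m).
  exact: (positive_part_arrow api_TPp).
- by move=> c c' /(congr1 sval); exact: IPq_eq.
- move=> X; exists (pi_IPp X); exact: (positive_part_arrow api_IPp).
- move=> c c' /(congr1 sval) /=; rewrite -!Psi_bp_plus => /Psi_inj.
  exact: BPq_eq.
- move=> X; have [l <-] := Psi_plus_surj X; exists (pi_BPp l).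
  exact: (positive_part_arrow api_BPp).
Qed.

(** Invariance forces [f] to be [positive_part] at [u] followed by the inverse of [positive_part] at
    [v]. *)
Lemma bijective_arrow u v (f : carrier R A u -> carrier R A v) :
  (forall x, positive_part (f x) = positive_part x) ->
  reduced u -> reduced v -> bijective f.
Proof.
move=> fE /positive_part_bij bu /positive_part_bij [g gK Kg].
apply: (eq_bij (bij_comp (Bijective Kg gK) bu)) => x /=.
by rewrite -fE gK.
Qed.

(** * Commutativity of the diagram *)

Lemma positive_part_path u v (p : dpath u v) x :
  positive_part (dpath_map R A p x) = positive_part x.
Proof.
elim: p x => [{}u {}v a|{}u {}v z a p ih] x; first exact: positive_part_arrow.
by rewrite /= ih positive_part_arrow.
Qed.

(* The last branch is a junk value: the invariance fails for arrows into the
   reduced vertices. *)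
Definition inductive_measure v : carrier R A v -> IP R A :=
  match v with
  | vGP => @gp_ip R A
  | vTP => @Pi R A
  | vIP => id
  | vBP => @Psi R A
  | _ => fun x => sval (positive_part x)
  end.

Lemma inductive_measure_path u v (p : dpath u v) x : ~~ reduced v ->
  inductive_measure (dpath_map R A p x) = inductive_measure x.
Proof.
have arr y z (a : arrow y z) c : ~~ reduced z ->
    inductive_measure (arrow_map a c) = inductive_measure c.
  by case: a c => //= c _; rewrite ?Psi_Lambda ?Pi_Delta.
(* No arrow leaves the reduced vertices, so a path ending outside them never enters them. *)
have red y z (q : dpath y z) : ~~ reduced z -> ~~ reduced y.
  by elim: q => [{}y {}z|{}y z' {}z + _ ih /ih]; case.
elim: p x => [{}u {}v a|{}u {}v z a p ih] x nv; first exact: arr.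
by rewrite /= ih // arr //; exact: red p nv.
Qed.

(* Pi is not injective, so the inductive measure does not separate paths into TP;
   this predicate does. *)
Definition only_Delta u v : (carrier R A u -> carrier R A v) -> Prop :=
  match v with
  | vGP => fun=> False
  | vTP => match u with vGP => fun f => f = @Delta R A | _ => fun=> False end
  | _ => fun=> True
  end.

(** The tail of a longer path into [vTP] would, by induction, start at [vGP], where no arrow
    ends. *)
Lemma only_Delta_path u v (p : dpath u v) : only_Delta (dpath_map R A p).
Proof.
elim: p => [{}u {}v a|{}u {}v z a p]; first by case: a.
by case: z p => // p; case: a p.
Qed.

Lemma diagram_comm u v (p q : dpath u v) : dpath_map R A p = dpath_map R A q.
Proof.
have [rv|nrv] := boolP (reduced v).
  apply/funext => x; apply: (bij_inj (positive_part_bij rv)).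
  by rewrite !positive_part_path.
apply/funext => x; have := inductive_measure_path p x nrv.
rewrite -(inductive_measure_path q x nrv); case: v p q nrv => //= p q _.
(* The remaining end points are [vGP], which no path reaches, [vTP] and [vBP]. *)
- by have := only_Delta_path p.
- move=> _; have := only_Delta_path p; have := only_Delta_path q.
  by case: u p q x => //= p q x -> ->.
- exact: Psi_inj.
Qed.

End diagram_theory.

Theorem theorem4p37 (R : realType) (A : choiceType) :
  (* (a) *)
  ((forall (u v : vertex) (p q : dpath u v),
      dpath_map R A p = dpath_map R A q) /\
   (forall p : dpath vBP vBPp, dpath_map R A p = @phi_BP R A) /\
   (forall p : dpath vBP vBPq, dpath_map R A p = @pi_BP R A)) /\
  (* (b) *)
  (surjective (@Pi R A) /\
   surjective (@Lambda R A) /\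
   surjective (@pi_TP R A) /\
   surjective (@pi_IP R A) /\
   surjective (@Delta_plus R A) /\
   surjective (@phi_IP R A) /\
   surjective (@phi_TP R A) /\
   surjective (@gamma_GP R A) /\
   surjective (@gamma_plus R A)) /\
  (* (c) *)
  (bijective (@Psi R A) /\
   bijective (@Delta R A) /\
   bijective (@Pi_plus R A) /\
   bijective (@Psi_plus R A) /\
   bijective (@Lambda_plus R A) /\
   bijective (@Pi_hat R A) /\
   bijective (@Psi_hat R A) /\
   bijective (@Lambda_hat R A) /\
   bijective (@pi_IPp R A) /\
   bijective (@pi_TPp R A) /\
   bijective (@pi_BPp R A)).
Proof.
have surjP (B C : Type) (f : B -> C) :
    (forall y, exists x, f x = y) -> surjective f.
  by move=> fs y _; have [x] := fs y; exists x.
have Delta_bij := bijective_of (@Delta_inj R A) (@Delta_surj R A).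
have phi_TP_surj (m : TPp R A) : exists x, phi_TP x = m.
  by case: m => m pm; exists m; apply: sig_eq; exact: tp_plus_id.
have phi_IP_surj (X : IPp R A) : exists x, phi_IP x = X.
  by case: X => X pX; exists X; apply: sig_eq; exact: ip_plus_id.
split; [split; [|split]|split].
- exact: diagram_comm.
(* [phi_BP] and [pi_BP] are not arrows, so they are compared with a path through their images in
   IP+. *)
- move=> p; apply/funext => l.
  apply: (bij_inj (@positive_part_bij R A vBPp isT)).
  by rewrite positive_part_path; apply: sig_eq; rewrite /= Psi_bp_plus.
- move=> p; apply/funext => l.
  apply: (bij_inj (@positive_part_bij R A vBPq isT)).
  rewrite positive_part_path; apply: sig_eq => /=.
  by rewrite -!Psi_bp_plus bp_plus_repr.
- do !split; apply: surjP.
  + exact: Pi_surj.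
  (* A sequence inducing the same inductive measure as [l] is sent to [l], by injectivity of
     [Psi]. *)
  + move=> l; have [m E] := Pi_surj (Psi l); exists m.
    by apply: Psi_inj; rewrite Psi_Lambda.
  + by move=> c; exists (repr c); exact: reprK.
  + by move=> c; exists (repr c); exact: reprK.
  + move=> m; have [n <-] := phi_TP_surj m; have [e <-] := Delta_surj n.
    by exists e.
  + exact: phi_IP_surj.
  + exact: phi_TP_surj.
  + exact: gamma_surj.
  + move=> X; have [Y <-] := phi_IP_surj X; have [e <-] := gamma_surj Y.
    by exists e.
do !split.
- exact: bijective_of (@Psi_inj R A) (@Psi_surj R A).
- exact: Delta_bij.
- exact: (bijective_arrow (positive_part_arrow aPi_plus)).
(* Only the inverse of [Psi_plus] is an arrow, but [Psi_plus] is [positive_part] at [vBPp] by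
   definition. *)
- exact: (positive_part_bij (v := vBPp)).
- exact: (bijective_arrow (positive_part_arrow aLambda_plus)).
- exact: (bijective_arrow (positive_part_arrow aPi_hat)).
- exact: (bijective_arrow (positive_part_arrow aPsi_hat)).
- exact: (bijective_arrow (positive_part_arrow aLambda_hat)).
- exact: (bijective_arrow (positive_part_arrow api_IPp)).
- exact: (bijective_arrow (positive_part_arrow api_TPp)).
- exact: (bijective_arrow (positive_part_arrow api_BPp)).
Qed.
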